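(* Let $D(t)$, $t\ge 0$, be a strictly increasing Lévy process (subordinator) with $\mathbb E[e^{-sD(t)}]=e^{-t\psi_D(s)}$, let $E(t)=\inf\{r>0: D(r)>t\}$ be its inverse, and let $N_1(t)$ be a Poisson process with rate $\lambda>0$, independent of $D$. Then the time-changed Poisson process $N_1(E(t))$ is a renewal process whose IID waiting times $(J_n)_{n\ge1}$ satisfy $$\mathbb P(J_n>t)=\mathbb E\big[e^{-\lambda E(t)}\big],\qquad t\ge 0.$$
   Context: The Laplace exponent has the form $\psi_D(s)=bs+\int_0^\infty (1-e^{-sx})\,\phi_D(dx)$, $s\ge 0$, where $b\ge 0$ and $\phi_D$ is the Lévy measure of $D$. Since $D$ is strictly increasing, either $\phi_D(0,\infty)=\infty$ or $b>0$ (or both). The jump times of $N_1(E(t))$ are $\tau_n=\sup\{t>0: N_1(E(t))<n\}$, $n\ge 1$, and the waiting times between its jumps are $\tau_1$ and $\tau_n-\tau_{n-1}$ for $n\ge 2$. A renewal process with waiting times $(J_n)$ is a process of the form $\max\{n\ge0: J_1+\cdots+J_n\le t\}$ with $(J_n)$ IID nonnegative random variables. *)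

(* Defs.v *)
From mathcomp Require Import all_boot all_order all_algebra finmap.
From mathcomp Require Import all_classical all_reals all_analysis.

Set Implicit Arguments.
Unset Strict Implicit.
Unset Printing Implicit Defensive.

Import Order.TTheory GRing.Theory Num.Theory.
Import numFieldTopology.Exports numFieldNormedType.Exports.

Local Open Scope classical_set_scope.
Local Open Scope ring_scope.

(* Processes are plain functions of type R -> T -> S; only the indices t >= 0
   are ever constrained or used. *)

Definition mutually_independent (d d' : measure_display)
    (T : measurableType d) (S : measurableType d') (R : realType)
    (P : probability T R) (I : choiceType) (X : I -> T -> S) : Prop :=
  forall (F : {fset I}) (B : I -> set S), (forall i, measurable (B i)) ->
    P (\bigcap_(i in [set` F]) (X i @^-1` B i)) =
    (\prod_(i <- F) P (X i @^-1` B i))%E.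

Definition same_distribution (d d' : measure_display)
    (T : measurableType d) (S : measurableType d') (R : realType)
    (P : probability T R) (X Y : T -> S) : Prop :=
  forall B : set S, measurable B -> P (X @^-1` B) = P (Y @^-1` B).

Definition process_sigma_algebra (d d' : measure_display)
    (T : measurableType d) (S : measurableType d') (R : realType)
    (X : R -> T -> S) : set (set T) :=
  <<s [set A | exists t (B : set S),
         [/\ 0 <= t, measurable B & A = X t @^-1` B]] >>.

Definition independent_processes (d d1 d2 : measure_display)
    (T : measurableType d) (S1 : measurableType d1) (S2 : measurableType d2)
    (R : realType) (P : probability T R)
    (X : R -> T -> S1) (Y : R -> T -> S2) : Prop :=
  forall A B : set T, process_sigma_algebra X A -> process_sigma_algebra Y B ->
    P (A `&` B) = (P A * P B)%E.

Definition cadlag (R : realType) (x : R -> R) : Prop :=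
  (forall t, 0 <= t -> x s @[s --> t^'+] --> x t) /\
  (forall t, 0 < t -> cvg (x s @[s --> t^'-])).

(* Stochastic continuity is not listed: it follows from right-continuity and
   the stationarity of the increments.  Finitely many times t_0 <= ... <= t_n
   extend to an infinite nondecreasing sequence that is constant after t_n. *)
Record levy_process (d : measure_display) (T : measurableType d)
    (R : realType) (P : probability T R) (X : R -> T -> R) : Prop := {
  levy_measurable : forall t, 0 <= t -> measurable_fun [set: T] (X t) ;
  levy_start : {ae P, forall w, X 0 w = 0} ;
  levy_independent_increments : forall t : nat -> R,
    0 <= t 0%N -> (forall i, t i <= t i.+1) ->
    mutually_independent P (fun i w => X (t i.+1) w - X (t i) w) ;
  levy_stationary_increments : forall s t, 0 <= s -> s <= t ->
    same_distribution P (fun w => X t w - X s w) (X (t - s)) ;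
  levy_cadlag : {ae P, forall w, cadlag (X ^~ w)}
}.

Definition strictly_increasing_paths (d : measure_display)
    (T : measurableType d) (R : realType) (P : probability T R)
    (X : R -> T -> R) : Prop :=
  {ae P, forall w, forall s t, 0 <= s -> s < t -> X s w < X t w}.

(* A Lévy measure of a subordinator, as a measure on R carried by (0, +oo). *)
Definition subordinator_levy_measure (R : realType)
    (phi : {measure set (measurableTypeR R) -> \bar R}) : Prop :=
  phi [set x : R | x <= 0] = 0%E /\
  (\int[phi]_(x in `]0%R, +oo[) (Num.min 1 x)%:E < +oo)%E.

Definition laplace_exponent (R : realType) (b : R)
    (phi : {measure set (measurableTypeR R) -> \bar R}) (s : R) : R :=
  b * s + \int[phi]_(x in `]0, +oo[) (1 - expR (- (s * x))).

(* The law is prescribed for t > 0 only, because [poisson_pmf 0 k] is 1 for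
   every k; N 0 = 0 almost surely is part of [levy_process]. *)
Definition poisson_process (d : measure_display) (T : measurableType d)
    (R : realType) (P : probability T R) (lambda : R) (N : R -> T -> nat)
    : Prop :=
  levy_process P (fun t w => (N t w)%:R) /\
  (forall t k, 0 < t ->
    P (N t @^-1` [set k]) = (poisson_pmf (lambda * t) k)%:E).

(* E(t), with inf set0 = +oo. *)
Definition inverse_process (d : measure_display) (T : measurableType d)
    (R : realType) (D : R -> T -> R) (t : R) (w : T) : \bar R :=
  ereal_inf [set r%:E | r in [set r | 0 < r /\ t < D r w]].

(* N(E(t)); the value N(0) given where E(t) = +oo is immaterial, since D tends
   to +oo almost surely. *)
Definition time_changed (d : measure_display) (T : measurableType d)
    (R : realType) (N : R -> T -> nat) (E : R -> T -> \bar R)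
    (t : R) (w : T) : nat :=
  N (fine (E t w)) w.

Definition jump_time (d : measure_display) (T : measurableType d)
    (R : realType) (Y : R -> T -> nat) (n : nat) (w : T) : \bar R :=
  ereal_sup [set t%:E | t in [set t | 0 < t /\ (Y t w < n)%N]].

(* Waiting times are indexed from 0: [waiting_time Y n] is tau_(n+1) - tau_n,
   and tau_1 for n = 0. *)
Definition waiting_time (d : measure_display) (T : measurableType d)
    (R : realType) (Y : R -> T -> nat) (n : nat) (w : T) : \bar R :=
  if n is m.+1 then (jump_time Y m.+2 w - jump_time Y m.+1 w)%E
  else jump_time Y 1 w.

(* J n stands for J_(n+1). *)
Record renewal_process (d : measure_display) (T : measurableType d)
    (R : realType) (P : probability T R) (Y : R -> T -> nat)
    (J : nat -> {RV P >-> R}) : Prop := {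
  renewal_ge0 : forall n w, 0 <= J n w ;
  renewal_independent : mutually_independent P (fun n => J n : T -> R) ;
  renewal_identically_distributed :
    forall m n, same_distribution P (J m) (J n) ;
  renewal_max : {ae P, forall w, forall t, 0 <= t ->
    \sum_(i < Y t w) J i w <= t /\
    (forall n : nat, \sum_(i < n) J i w <= t -> (n <= Y t w)%N)}
}.

(* Main.v *)
(* N(E(t)) < n means that D(r) > t for some r with N(r) < n.  Hence, almost surely,
   the n-th jump time of N(E) is the supremum tau_n of D over {r | N(r) < n}.

   On a grid of step h, mark the cells in which N jumps exactly once, all the
   others before the last mark being free of jumps.  The gaps between marks are
   then independent and geometric, so the increments of D between marks are
   exactly independent, by the independence of the increments of N and of D and
   of N from D.  The marks exist with probability tending to 1 as h -> 0, and
   these increments of D then converge to the waiting times J_n = tau_(n+1) - tau_n.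
   The first one converges from below, which gives convergence of the tails
   without any continuity assumption; the joint tails follow, up to >= versus >,
   and the right-continuity of the tail function removes this ambiguity.

   Conditioning on the grid cell in which D crosses t gives
   P(tau_1 > t) = E[exp(- lambda E(t))]. *)

From HB Require Import structures.
Require Import Defs.
From mathcomp Require Import all_boot all_order all_algebra finmap.
From mathcomp Require Import ring lra.
From mathcomp Require Import all_classical all_reals all_analysis measurable_realfun.

Set Implicit Arguments.
Unset Strict Implicit.
Unset Printing Implicit Defensive.

Import Order.TTheory GRing.Theory Num.Theory.
Import numFieldTopology.Exports numFieldNormedType.Exports.

Local Open Scope classical_set_scope.
Local Open Scope ring_scope.

(** The jump times of N are random, so the independence of increments over fixed times does not
    apply directly to the increments of D between them. The grid removes this obstacle: for each
    fixed list of gaps all increments are taken between deterministic times, and summing over the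
    lists turns a sum of products into a product of sums, one factor per waiting time. With step
    1/(k+1) and gaps below (k+1)^2, the mesh tends to 0 while the time range allowed to each gap
    tends to infinity. Increments of D are taken between the left ends of the marked cells, so that
    D is seen before the jump of N, in accordance with tau_n being a left limit of D. All path
    arguments take place on one measurable event of probability 1. The waiting times are set to 0
    off it, which makes them measurable without completeness of P. The Laplace transform at s = 1
    supplies the unboundedness of D, on which the finiteness of E(t) rests. *)

(** Deterministic form of what the path arguments use. Given monotonicity, [good_N_right] is
    right-continuity of an integer-valued path: [N] is constant on [[t, u]]. *)
Record good_path (d : measure_display) (T : measurableType d) (R : realType)
    (D : R -> T -> R) (N : R -> T -> nat) (w : T) : Prop := {
  good_D0 : D 0 w = 0 ;
  good_D_lt : forall s t, 0 <= s -> s < t -> D s w < D t w ;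
  good_D_unbounded : forall x, exists2 t, 0 <= t & x < D t w ;
  good_N0 : N 0 w = 0%N ;
  good_N_le : forall s t, 0 <= s -> s <= t -> (N s w <= N t w)%N ;
  good_N_right : forall t, 0 <= t -> exists2 u, t < u & (N u w <= N t w)%N ;
  good_N_unbounded : forall n, exists2 t, 0 <= t & (n <= N t w)%N
}.

(* If S_n is the n-th jump time of N, this is the left limit of D at S_n; it is 0
   for n = 0, the supremum of the empty set. *)
Definition passage (d : measure_display) (T : measurableType d) (R : realType)
    (D : R -> T -> R) (N : R -> T -> nat) (n : nat) (w : T) : R :=
  sup [set D r w | r in [set r | 0 <= r /\ (N r w < n)%N]].

(** * Path properties of the passage values and of the inverse *)

Section paths.
Context (d : measure_display) (T : measurableType d) (R : realType).
Context (D : R -> T -> R) (N : R -> T -> nat) (w : T).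
Hypothesis good : good_path D N w.

Let D_le s t : 0 <= s -> s <= t -> D s w <= D t w.
Proof.
move=> s0; rewrite le_eqVlt => /predU1P[->//|st].
exact/ltW/(good_D_lt good).
Qed.

Let D_ltI s t : 0 <= s -> D t w < D s w -> t < s.
Proof.
by move=> s0; apply: contraTT; rewrite -!leNgt; exact: D_le.
Qed.

Let N_ltI s t : 0 <= s -> (N t w < N s w)%N -> t < s.
Proof.
move=> s0; apply: contraTT; rewrite -leqNgt -leNgt; exact: (good_N_le good).
Qed.

Lemma passage0 : passage D N 0 w = 0.
Proof.
rewrite /passage (_ : [set _ | _ in _] = set0) ?sup0//.
by apply/seteqP; split => // x [r []].
Qed.

Lemma passage_has_sup n :
  has_sup [set D r w | r in [set r | 0 <= r /\ (N r w < n.+1)%N]].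
Proof.
split; first by exists (D 0 w), 0 => //=; rewrite (good_N0 good).
have [t t0 nt] := good_N_unbounded good n.+1.
exists (D t w) => _ [r [r0 rn] <-]; apply: D_le => //.
by apply/ltW/N_ltI => //; exact: leq_trans rn nt.
Qed.

Lemma le_passage r n : 0 <= r -> (N r w < n)%N -> D r w <= passage D N n w.
Proof.
case: n => // n r0 rn; apply: sup_upper_bound; first exact: passage_has_sup.
by exists r.
Qed.

Lemma lt_passageP x n :
  x < passage D N n.+1 w <-> exists r, [/\ 0 <= r, (N r w < n.+1)%N & x < D r w].
Proof.
split=> [|[r [r0 rn xr]]]; last exact: lt_le_trans xr (le_passage r0 rn).
move=> /(sup_gt (proj1 (passage_has_sup n)))[_ [r [r0 rn] <-] xr].
by exists r.
Qed.

(* Right-continuity of N leaves room to move a witness to the right. *)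
Lemma lt_passage_open x n : x < passage D N n.+1 w ->
  exists r u, [/\ 0 <= r, r < u, (N u w < n.+1)%N & x < D r w].
Proof.
move=> /lt_passageP[r [r0 rn xr]]; have [u ru Nu] := good_N_right good r0.
by exists r, u; split => //; exact: leq_ltn_trans Nu rn.
Qed.

(** The open interval given by right-continuity contains a rational. Countably many witnesses are
    what makes the passage values measurable. *)
Lemma lt_passage_rat x n : x < passage D N n.+1 w <->
  exists q : rat, [/\ 0 <= ratr q :> R, (N (ratr q) w < n.+1)%N & x < D (ratr q) w].
Proof.
split=> [/lt_passage_open[r [u [r0 ru Nu xr]]]|[q qP]]; last first.
  by apply/lt_passageP; exists (ratr q).
have [q] := rat_in_itvoo ru; rewrite in_itv/= => /andP[rq qu].
have q0 : 0 <= ratr q :> R by rewrite (le_trans r0)// ltW.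
exists q; split => //.
  by rewrite (leq_ltn_trans _ Nu)// (good_N_le good)// ltW.
by rewrite (lt_le_trans xr)// D_le// ltW.
Qed.

Lemma passage_ge0 n : 0 <= passage D N n w.
Proof.
case: n => [|n]; first by rewrite passage0.
by rewrite -(good_D0 good); apply: le_passage => //; rewrite (good_N0 good).
Qed.

(** Jump times are suprema over t > 0; positivity of the passage values keeps these sets of times
    nonempty. *)
Lemma passage1_gt0 : 0 < passage D N 1 w.
Proof.
have [u u0 Nu] := good_N_right good (lexx 0).
apply/lt_passageP; exists u; split => //; first exact: ltW.
  by rewrite (good_N0 good) in Nu.
by rewrite -{1}(good_D0 good); exact: (good_D_lt good).
Qed.

Lemma passage_le m n : (m <= n)%N -> passage D N m w <= passage D N n w.
Proof.
case: m => [|m]; first by rewrite passage0 passage_ge0.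
case: n => // n mn; rewrite leNgt; apply/negP => /lt_passageP[r [r0 rm]].
by apply/negP; rewrite -leNgt; apply: le_passage => //; exact: leq_trans rm mn.
Qed.

Let E t : \bar R := inverse_process D t w.

Lemma inverse_fin t : 0 <= t -> E t \is a fin_num /\ 0 <= fine (E t).
Proof.
move=> t0; have [r r0 tr] := good_D_unbounded good t.
have r_gt0 : 0 < r.
  by apply: D_ltI => //; rewrite (good_D0 good) (le_lt_trans t0).
have E0 : (0 <= E t)%E.
  by apply: le_ereal_inf_tmp => _ [s [s0 _] <-]; rewrite lee_fin ltW.
have Er : (E t <= r%:E)%E by apply: ereal_inf_lbound; exists r.
split; last exact: fine_ge0.
by rewrite fin_numElt (lt_le_trans _ E0)//= (le_lt_trans Er)// ltry.
Qed.

Lemma inverse_le t r : 0 <= t -> 0 <= r -> t < D r w -> fine (E t) <= r.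
Proof.
move=> t0 r0 tr; have [Efin _] := inverse_fin t0.
rewrite -lee_fin fineK//; apply: ereal_inf_lbound; exists r => //; split => //.
by apply: D_ltI => //; rewrite (good_D0 good) (le_lt_trans t0).
Qed.

Lemma inverse_ge t r : 0 <= t -> 0 <= r -> D r w <= t -> r <= fine (E t).
Proof.
move=> t0 r0 tr; have [Efin _] := inverse_fin t0.
rewrite -lee_fin fineK//; apply: le_ereal_inf_tmp => _ [s [s0 ts] <-].
by rewrite lee_fin; apply/ltW/D_ltI; [exact: ltW|exact: le_lt_trans ts].
Qed.

Lemma inverse_lt t u : 0 <= t -> fine (E t) < u -> t < D u w.
Proof.
move=> t0 Etu; have [_ E0] := inverse_fin t0.
rewrite ltNge; apply/negP => /(inverse_ge t0 (le_trans E0 (ltW Etu))).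
by rewrite leNgt Etu.
Qed.

(** Right-continuity of [N] at E(t) gives a time after E(t) at which [N] is still below n and [D]
    already exceeds t. Conversely, a time with these two properties is at least E(t), and [N] is
    monotone. *)
Lemma time_changed_lt t n : 0 <= t ->
  (time_changed N (inverse_process D) t w < n)%N <-> t < passage D N n w.
Proof.
move=> t0; case: n => [|n]; first by rewrite passage0 ltNge t0.
have [_ E0] := inverse_fin t0; split => [Yn|].
  have [u Eu Nu] := good_N_right good E0.
  apply/lt_passageP; exists u; split; first exact: le_trans (ltW Eu).
    exact: leq_ltn_trans Nu Yn.
  exact: inverse_lt.
move=> /lt_passageP[r [r0 rn tr]]; apply: leq_ltn_trans rn.
by apply: (good_N_le good) => //; exact: inverse_le.
Qed.

Lemma jump_time_passage n :
  jump_time (time_changed N (inverse_process D)) n.+1 w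
  = (passage D N n.+1 w)%:E.
Proof.
have tau0 : 0 < passage D N n.+1 w.
  exact: lt_le_trans passage1_gt0 (passage_le (ltn0Sn n)).
apply/eqP; rewrite eq_le; apply/andP; split.
  apply: ge_ereal_sup => _ [t [t0 Yt] <-]; rewrite lee_fin ltW//.
  by apply/time_changed_lt => //; exact: ltW.
apply/lee_addgt0Pr => e e0.
(* [jump_time] admits only t > 0, so when tau - e is not positive the witness is tau / 2 instead. *)
have [lte|lee] := ltP 0 (passage D N n.+1 w - e); last first.
  apply: (@le_trans _ _ (e / 2 + passage D N n.+1 w / 2)%:E).
    by rewrite lee_fin; lra.
  have: ((passage D N n.+1 w / 2)%:E <=
      jump_time (time_changed N (inverse_process D)) n.+1 w)%E.
    apply: ereal_sup_ubound; exists (passage D N n.+1 w / 2) => //; split; first lra.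
    by apply/time_changed_lt; lra.
  rewrite EFinD addeC => /leeD; apply; rewrite lee_fin; lra.
rewrite -leeBlDr// -EFinB; apply: ereal_sup_ubound.
by exists (passage D N n.+1 w - e) => //; split => //; apply/time_changed_lt; lra.
Qed.

(** Choose r < u with D(r) > tau - e and N(u) <= n. A cell shorter than u - r that contains the jump
    ends after u, hence starts after r, where D is already close to tau. The upper bound holds
    because N = n at the left end of the cell. *)
Lemma passage_near n e : 0 < e -> exists2 del : R, 0 < del &
  forall s h, 0 <= s -> 0 < h -> h < del -> N s w = n -> N (s + h) w = n.+1 ->
    passage D N n.+1 w - e < D s w <= passage D N n.+1 w.
Proof.
move=> e0; have : passage D N n.+1 w - e < passage D N n.+1 w by lra.
move=> /lt_passage_open[r [u [r0 ru Nu er]]]; exists (u - r); first lra.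
move=> s h s0 h0 hd Ns Nsh; rewrite le_passage ?Ns// andbT.
rewrite (lt_le_trans er)// D_le//.
have : u < s + h by apply: N_ltI; [lra|rewrite Nsh].
lra.
Qed.

(** From D(s) <= t < D(r) follows s < r, and a cell shorter than u - r starting at s ends before u,
    where [N] is still 0. *)
Lemma passage1_inverse_near t : 0 <= t -> t < passage D N 1 w ->
  exists2 del : R, 0 < del & forall s h, 0 <= s -> 0 < h -> h < del ->
    D s w <= t -> N (s + h) w = 0%N.
Proof.
move=> t0 /lt_passage_open[r [u [r0 ru Nu tr]]]; exists (u - r); first lra.
move=> s h s0 h0 hd Dst; have sr : s < r by apply: D_ltI => //; exact: le_lt_trans tr.
apply/eqP; rewrite -leqn0 -ltnS (leq_ltn_trans _ Nu)// (good_N_le good)//; lra.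
Qed.

End paths.

(** * Limits of probabilities along sequences of events *)

Section prob_limits.
Context (d : measure_display) (T : measurableType d) (R : realType).
Variable P : probability T R.

Let pr (A : set T) : R := fine (P A).

Let prE (A : set T) : measurable A -> P A = (pr A)%:E.
Proof. by move=> mA; rewrite fineK// fin_num_measure. Qed.

(** Fatou's lemma for events, by continuity from below: the parts of [X] on which [B k] holds from
    index m on increase to [X]. The sequence [x] of lower bounds stands in for a liminf. *)
Lemma probability_liminf (X : set T) (B : nat -> set T) :
  measurable X -> (forall k, measurable (B k)) ->
  (forall w, X w -> \forall k \near \oo, B k w) ->
  exists2 x : nat -> R, x @ \oo --> fine (P X) &
    forall k, ((x k)%:E <= P (B k))%E.
Proof.
move=> mX mB XB.
pose L m := X `&` \bigcap_(k in [set k | (m <= k)%N]) B k.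
have mL m : measurable (L m).
  by apply: measurableI => //; apply: bigcap_measurable => //; exists m => /=.
have UL : \bigcup_m L m = X.
  apply/seteqP; split => [w [m _ []]//|w Xw]; have [m _ mw] := XB w Xw.
  by exists m => //; split => // k /= mk; exact: mw.
have LL : {homo L : n m / (n <= m)%N >-> (n <= m)%O}.
  move=> m n mn; apply/subsetPset => w [Xw Lw]; split => // k /= nk.
  by apply: Lw => /=; exact: leq_trans nk.
exists (pr \o L) => [|k /=]; last first.
  rewrite -prE//; apply: le_measure; rewrite ?inE// => w [_]; apply.
  exact: leqnn.
apply: fine_cvg; rewrite fineK ?fin_num_measure// -[X in P X]UL.
by apply: nondecreasing_cvg_mu => //; rewrite UL.
Qed.

Lemma probability_le_liminf (X : set T) (B : nat -> set T) (c : nat -> R) (l : R) :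
  measurable X -> (forall k, measurable (B k)) ->
  (forall w, X w -> \forall k \near \oo, B k w) ->
  (forall k, (P (B k) <= (c k)%:E)%E) -> c @ \oo --> l -> (P X <= l%:E)%E.
Proof.
move=> mX mB XB Bc cl; have [x xX xB] := probability_liminf mX mB XB.
rewrite prE// lee_fin; apply: ler_cvg_to xX cl _; apply: nearW => k.
by rewrite -lee_fin; exact: le_trans (xB k) (Bc k).
Qed.

(** The inclusion bounds P(A k) above by P(X); the lower bound passes through events [B k] whose
    probability exceeds that of [A k] by at most [e k]. In the main use, [B k] adds to [A k] the
    failure of the grid to produce its marks. *)
Lemma probability_cvg_inner (X : set T) (A B : nat -> set T) (e : nat -> R) :
  measurable X -> (forall k, measurable (A k)) -> (forall k, measurable (B k)) ->
  (forall w, X w -> \forall k \near \oo, B k w) -> (forall k, A k `<=` X) ->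
  (forall k, (P (B k) <= P (A k) + (e k)%:E)%E) -> e @ \oo --> (0 : R) ->
  (fine (P (A k)) @[k --> \oo] --> fine (P X)).
Proof.
move=> mX mA mB XB AX BAe e0; have [x xX xB] := probability_liminf mX mB XB.
have xe : x k - e k @[k --> \oo] --> fine (P X).
  by rewrite -[X in _ --> X]subr0; apply: cvgB.
apply: (squeeze_cvgr _ xe (cvg_cst (fine (P X)))); apply: nearW => k.
apply/andP; split.
  rewrite lerBlDr -lee_fin EFinD -prE//; exact: le_trans (xB k) (BAe k).
by rewrite -lee_fin -!prE//; apply: le_measure; rewrite ?inE.
Qed.

Lemma probability_ge_limsup (X : set T) (A : nat -> set T) (c : nat -> R) (l : R) :
  measurable X -> (forall k, measurable (A k)) ->
  (forall w, ~ X w -> \forall k \near \oo, ~ A k w) ->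
  (forall k, ((c k)%:E <= P (A k))%E) -> c @ \oo --> l -> (l%:E <= P X)%E.
Proof.
move=> mX mA XA cA cl.
have : (P (~` X) <= (1 - l)%:E)%E.
  apply: (@probability_le_liminf _ (fun k => ~` A k) (fun k => 1 - c k)).
  - exact: measurableC.
  - by move=> k; exact: measurableC.
  - exact: XA.
  - move=> k; rewrite probability_setC// EFinB leeB//; exact: cA.
  - by apply: cvgB => //; exact: cvg_cst.
rewrite probability_setC// EFinB.
have -> : P X = (fine (P X))%:E by rewrite fineK// fin_num_measure.
by rewrite -!EFinB !lee_fin; lra.
Qed.

Lemma probability_setI1 (A O : set T) : measurable A -> measurable O ->
  P O = 1%E -> P (A `&` O) = P A.
Proof.
move=> mA mO PO; have PC : P (~` O) = 0%E.
  by rewrite probability_setC// PO subee.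
rewrite -[in RHS](setUIDK A O) measureU0//.
- exact: measurableI.
- exact: measurableD.
- apply: (@subset_measure0 _ _ _ P _ (~` O)) => //.
  + exact: measurableD.
  + exact: measurableC.
Qed.

Lemma probability_bigcap1 (U : nat -> set T) :
  (forall n, measurable (U n)) -> (forall n, P (U n) = 1%E) ->
  P (\bigcap_n U n) = 1%E.
Proof.
move=> mU PU; have mV : measurable (\bigcap_n U n) by apply: bigcapT_measurable.
have : P (~` \bigcap_n U n) = 0%E.
  apply/eqP; rewrite -measure_le0 setC_bigcap.
  rewrite (le_trans (generalized_Boole_inequality P _ _))//.
  - by move=> n; exact: measurableC.
  - by apply: bigcup_measurable => n _; exact: measurableC.
  rewrite eseries0// => n _ _.
  by etransitivity; [exact: (probability_setC P (mU n))|rewrite PU subee].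
move=> PC; rewrite -[X in P X]setCK probability_setC ?PC ?sube0//.
exact: measurableC.
Qed.

Lemma ae_measurable_set (Q : T -> Prop) : {ae P, forall w, Q w} ->
  exists O : set T, [/\ measurable O, P O = 1%E & forall w, O w -> Q w].
Proof.
move=> [A [mA PA QA]]; exists (~` A); split.
- exact: measurableC.
- by rewrite probability_setC// PA sube0.
- by move=> w Aw; apply: contrapT => /QA.
Qed.

(* E(t) is an infimum over uncountably many times and P is not assumed complete,
   so exp(- lambda E(t)) may fail to be measurable off the set O. *)
Lemma ge0_integral_full (f g : T -> \bar R) (O : set T) :
  measurable O -> P O = 1%E -> measurable_fun setT g ->
  (forall w, 0 <= f w <= 1)%E -> (forall w, O w -> f w = g w) ->
  (forall w, ~ O w -> g w = 0)%E ->
  (\int[P]_w f w = \int[P]_w g w)%E.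
Proof.
move=> mO PO mg f01 fg g0.
have f_ge0 w : (0 <= f w)%E by have /andP[] := f01 w.
have g_ge0 w : (0 <= g w)%E by have [/fg<-//|/g0->//] := pselect (O w).
(* [f] is not assumed measurable, so monotonicity is read off the definition of the integral as a
   supremum over simple functions. *)
have le_int (u v : T -> \bar R) : (forall w, 0 <= u w)%E ->
    (forall w, u w <= v w)%E -> (\int[P]_w u w <= \int[P]_w v w)%E.
  move=> u0 uv; rewrite !ge0_integralTE//; last first.
    by move=> w; exact: le_trans (uv w).
  apply: ge_ereal_sup => _ [h hu <-]; apply: ereal_sup_ubound; exists h => // w.
  exact: le_trans (uv w).
apply/eqP; rewrite eq_le; apply/andP; split; last first.
  by apply: le_int => // w; have [/fg->//|/g0->//] := pselect (O w).
have : (\int[P]_w f w <= \int[P]_w (g w + (\1_(~` O) w)%:E))%E.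
  apply: le_int => // w; have [Ow|Ow] := pselect (O w).
    by rewrite fg// leeDl// lee_fin.
  by rewrite g0// add0e indicE mem_set//; have /andP[] := f01 w.
rewrite ge0_integralD//; last first.
  by apply/measurable_EFinP/measurable_indic; exact: measurableC.
rewrite integral_indic ?setIT//; last exact: measurableC.
have PC : P (~` O) = 0%E by rewrite probability_setC// PO subee.
by rewrite [X in (_ + X)%E]PC adde0.
Qed.

End prob_limits.

(** * From rays to Borel sets *)

Section rays.
Context (d : measure_display) (T : measurableType d) (R : realType).
Variable P : probability T R.

(** Rays are stable under intersection and generate the Borel sets, and the rays starting at -k have
    finite measure and exhaust the line. *)
Lemma eq_measure_rays (m1 m2 : {measure set R -> \bar R}) :
  (forall t, m1 `]t, +oo[%classic = m2 `]t, +oo[%classic) ->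
  (forall t, m1 `]t, +oo[%classic < +oo)%E ->
  forall B, measurable B -> m1 B = m2 B.
Proof.
move=> m12 m1oo; apply: (@measure_unique _ _ _ (@RGenOInfty.G R)
  (fun k => `](- k%:R : R), +oo[%classic)).
- exact: RGenOInfty.measurableE.
- move=> _ _ [x ->] [y ->]; exists (Num.max x y).
  apply/seteqP; split => z /=; rewrite !in_itv/= !andbT gt_max.
    by move=> [-> ->].
  by move=> /andP[].
- by move=> k; eexists.
- apply/seteqP; split => // x _; exists (Num.truncn `|x|).+1 => //=.
  rewrite in_itv/= andbT ltrNl (le_lt_trans (ler_norm _))// normrN.
  exact: truncnS_gt.
- by move=> _ [x ->].
- by move=> k.
Qed.

Lemma same_distribution_rays (X Y : {RV P >-> R}) :
  (forall t, P [set w | t < X w] = P [set w | t < Y w]) ->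
  same_distribution P X Y.
Proof.
move=> XY B mB.
apply: (@eq_measure_rays (distribution P X) (distribution P Y)) => // t.
- have e (Z : {RV P >-> R}) :
      distribution P Z `]t, +oo[%classic = P [set w | t < Z w].
    by congr (P _); apply/seteqP; split => w /=; rewrite in_itv/= andbT.
  by etransitivity; [exact: e|rewrite XY; exact/esym/e].
- by rewrite ltey_eq fin_num_measure.
Qed.

Lemma mutually_independent_rays (X : nat -> {RV P >-> R}) :
  (forall (F : {fset nat}) (t : nat -> R),
    P (\bigcap_(i in [set` F]) [set w | t i < X i w]) =
    (\prod_(i <- F) P [set w | (t i < X i w)%R])%E) ->
  mutually_independent P (fun i => X i : T -> R).
Proof.
move=> Xray F0 B0 mB0.
pose rays (B : nat -> set R) i := exists t, B i = `]t, +oo[%classic.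
(* Induction on the list [s] of indices whose set may be arbitrary; outside [s] only rays are
   allowed. The empty list is the hypothesis, and [s = F0] is the claim. *)
suff H (s : seq nat) : forall (F : {fset nat}) (B : nat -> set R),
    (forall i, measurable (B i)) -> (forall i, i \in F -> i \notin s -> rays B i) ->
    P (\bigcap_(i in [set` F]) (X i @^-1` B i)) =
    (\prod_(i <- F) P (X i @^-1` B i))%E.
  by apply: (H F0) => // i ->.
elim: s => [|a s IH] F B mB rB.
  have /choice[t tP] i : exists t, i \in F -> B i = `]t, +oo[%classic.
    by have [iF|iF] := boolP (i \in F);
      [have [t tB] := rB i iF isT; exists t|exists 0].
  have XE i : i \in F -> X i @^-1` B i = [set w | t i < X i w].
    by move=> /tP ->; apply/seteqP; split => w /=; rewrite in_itv/= andbT.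
  rewrite (eq_bigcapr XE) Xray !big_seq; apply: eq_bigr => i /XE ->//.
have [aF|aF] := boolP (a \in F); last first.
  apply: IH => // i iF is_; apply: rB => //; rewrite in_cons negb_or is_ andbT.
  by apply: contraNneq aF => <-.
pose Z := \bigcap_(i in [set` (F `\ a)%fset]) (X i @^-1` B i).
have mXB i S : measurable S -> measurable (X i @^-1` S).
  by move=> mS; rewrite -[_ @^-1` _]setTI; exact: measurable_funP.
have mZ : measurable Z.
  by apply: fin_bigcap_measurable => // i _; exact: mXB.
pose c := (\prod_(i <- (F `\ a)%fset) P (X i @^-1` B i))%E.
have ZE : P Z = c.
  apply: IH => // i; rewrite !inE => /andP[ia iF] is_.
  by apply: rB => //; rewrite in_cons negb_or ia.
have cfin : c \is a fin_num by rewrite -ZE fin_num_measure.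
have c0 : 0 <= fine c by rewrite fine_ge0// -ZE.
(* As functions of the set in coordinate [a], both sides are finite measures; the induction
   hypothesis makes them agree on rays. *)
pose m1 := pushforward (mrestr P mZ) (X a).
pose m2 := mscale (NngNum c0) (distribution P (X a)).
have m1E S : m1 S = P (X a @^-1` S `&` Z) by [].
have m2E S : m2 S = (P (X a @^-1` S) * c)%E.
  by rewrite /m2/= /mscale/= fineK// muleC.
have FE : F = (a |` F `\ a)%fset by rewrite fsetD1K.
have capE : \bigcap_(i in [set` F]) (X i @^-1` B i) = X a @^-1` B a `&` Z.
  by rewrite [in LHS]FE set_fsetU set_fset1 bigcap_setU bigcap_set1.
have prodE (f : nat -> \bar R) :
    (\prod_(i <- F) f i = f a * \prod_(i <- (F `\ a)%fset) f i)%E.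
  by rewrite (big_fsetD1 a).
rewrite capE prodE -/c -m1E -m2E.
apply: eq_measure_rays => // t; last first.
  change (P (X a @^-1` `]t, +oo[%classic `&` Z) < +oo)%E.
  by rewrite ltey_eq fin_num_measure//; apply: measurableI => //; exact: mXB.
change (P (X a @^-1` `]t, +oo[%classic `&` Z) = m2 `]t, +oo[%classic).
rewrite m2E.
pose B' i := if i == a then `]t, +oo[%classic else B i.
have := IH F B'; rewrite prodE.
have -> : \bigcap_(i in [set` F]) (X i @^-1` B' i) = X a @^-1` `]t, +oo[%classic `&` Z.
  rewrite [in LHS]FE set_fsetU set_fset1 bigcap_setU bigcap_set1 /B' eqxx.
  congr (_ `&` _); apply: eq_bigcapr => i /=; rewrite !inE => /andP[/negbTE-> _].
  by [].
have -> : (\prod_(i <- (F `\ a)%fset) P (X i @^-1` B' i) = c)%E.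
  rewrite /c !big_seq; apply: eq_bigr => i; rewrite !inE => /andP[/negbTE ia _].
  by rewrite /B' ia.
have -> : B' a = `]t, +oo[%classic by rewrite /B' eqxx.
apply.
- by move=> i; rewrite /B'; case: ifP.
- move=> i iF is_; rewrite /rays /B'; case: eqVneq => ia; first by exists t.
  by apply: rB => //; rewrite in_cons negb_or ia.
Qed.

End rays.

(** * Increments of Lévy and Poisson processes *)

Section levy_facts.
Context (d : measure_display) (T : measurableType d) (R : realType).
Variable P : probability T R.

Lemma mutually_independent_ord (d' : measure_display) (S : measurableType d')
    (X : nat -> T -> S) (m : nat) (B : nat -> set S) :
  mutually_independent P X -> (forall i, measurable (B i)) ->
  P (\bigcap_(i < m) X i @^-1` B i) = (\prod_(i < m) P (X i @^-1` B i))%E.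
Proof.
move=> indep mB; have := indep [fset i | i in iota 0 m]%fset B mB.
have mem i : (i \in [fset i | i in iota 0 m]%fset) = (i < m)%N.
  by rewrite in_fset/= mem_iota add0n.
have -> : [set` [fset i | i in iota 0 m]%fset] = `I_m.
  by apply/seteqP; split => i /=; rewrite mem.
move=> ->; rewrite -(big_mkord xpredT (fun i => P (X i @^-1` B i))).
apply: perm_big; apply: uniq_perm; rewrite ?fset_uniq ?iota_uniq// => i.
by rewrite mem mem_index_iota.
Qed.

(** Measurability is proved in the sigma-algebra of the process, since independence of N and D is
    stated for these sigma-algebras. The map [f] accommodates the cast of N to the reals. *)
Lemma measurable_increment (d' : measure_display) (S : measurableType d')
    (X : R -> T -> S) (f : S -> R) (s t : R) (B : set R) :
  measurable_fun setT f -> 0 <= s -> 0 <= t -> measurable B ->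
  process_sigma_algebra X ((fun w => f (X t w) - f (X s w)) @^-1` B).
Proof.
move=> mf s0 t0 mB.
pose G := [set A | exists t (B : set S),
  [/\ 0 <= t, measurable B & A = X t @^-1` B]].
have mX u : 0 <= u ->
    measurable_fun setT ((fun w => f (X u w)) : g_sigma_algebraType G -> R).
  move=> u0 _ C mC; rewrite setTI; apply: sub_sigma_algebra.
  exists u, (f @^-1` C); split => //.
  by rewrite -[f @^-1` C]setTI; exact: mf.
have mXB : measurable_fun setT
    ((fun w => f (X t w) - f (X s w)) : g_sigma_algebraType G -> R).
  by apply: measurable_funB; exact: mX.
by rewrite -[_ @^-1` _]setTI; apply: mXB.
Qed.

Lemma process_sigma_algebra_bigcap (d' : measure_display) (S : measurableType d')
    (X : R -> T -> S) (A : nat -> set T) (n : nat) :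
  (forall i, process_sigma_algebra X (A i)) ->
  process_sigma_algebra X (\bigcap_(i < n) A i).
Proof.
move=> mA; pose G := [set A | exists t (B : set S),
  [/\ 0 <= t, measurable B & A = X t @^-1` B]].
apply: (@fin_bigcap_measurable _ (g_sigma_algebraType G)).
  exact: finite_II.
by move=> i _; exact: mA.
Qed.

Variables (N : R -> T -> nat) (lambda : R).
Hypothesis N_poisson : poisson_process P lambda N.

Lemma poisson_increment (s t : R) (k : nat) : 0 <= s -> s < t ->
  P ((fun w => (N t w)%:R - (N s w)%:R) @^-1` [set k%:R : R])
  = (poisson_pmf (lambda * (t - s)) k)%:E.
Proof.
move=> s0 st; have [levyN lawN] := N_poisson.
rewrite (levy_stationary_increments levyN s0 (ltW st))//.
rewrite -lawN ?subr_gt0//; congr (P _); apply/seteqP; split => w /=.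
  by move/eqP; rewrite eqr_nat => /eqP.
by move=> ->.
Qed.

(** The case s = t occurs because gaps may be empty; it is treated apart since the Poisson law is
    prescribed for positive times only. *)
Lemma poisson_increment0 (s t : R) : 0 < lambda -> 0 <= s -> s <= t ->
  P ((fun w => (N t w)%:R - (N s w)%:R) @^-1` [set 0 : R])
  = (expR (- (lambda * (t - s))))%:E.
Proof.
move=> l0 s0; rewrite le_eqVlt => /predU1P[->|st].
  rewrite subrr mulr0 oppr0 expR0 (_ : _ @^-1` _ = setT) ?probability_setT//.
  by apply/seteqP; split => w //= _; rewrite subrr.
rewrite -[0]/(0%:R) poisson_increment// /poisson_pmf mulr_gt0 ?subr_gt0//.
by rewrite expr0 fact0 invr1 !mul1r.
Qed.

Lemma poisson_increment1 (s t : R) : 0 < lambda -> 0 <= s -> s < t ->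
  P ((fun w => (N t w)%:R - (N s w)%:R) @^-1` [set 1 : R])
  = (lambda * (t - s) * expR (- (lambda * (t - s))))%:E.
Proof.
move=> l0 s0 st.
rewrite -[1]/(1%:R) poisson_increment// /poisson_pmf mulr_gt0 ?subr_gt0//.
by rewrite expr1 invr1 mulr1.
Qed.

End levy_facts.

(* The renewal grid: gap j has length g j, so the j-th mark sits on the cell
   [offset g j + g j, offset g j.+1] of the grid with step h. *)
Definition offset (g : nat -> nat) (j : nat) : nat := (\sum_(l < j) g l + j)%N.

Lemma offsetS g j : offset g j.+1 = (offset g j + g j).+1.
Proof. by rewrite /offset big_ord_recr/= addnS addnAC. Qed.

(** * Probability of a prescribed list of gaps and of events on the blocks of D *)

Section blocks.
Context (d : measure_display) (T : measurableType d) (R : realType).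
Variable P : probability T R.
Variables (D : R -> T -> R) (N : R -> T -> nat) (lambda : R).
Hypothesis D_levy : levy_process P D.
Hypothesis N_poisson : poisson_process P lambda N.
Hypothesis lambda_gt0 : 0 < lambda.
Hypothesis ND_indep : independent_processes P N D.

Definition mark_event (h : R) (g : nat -> nat) (j : nat) : set T :=
  (fun w => (N ((offset g j + g j)%:R * h) w)%:R - (N ((offset g j)%:R * h) w)%:R)
     @^-1` [set 0 : R] `&`
  (fun w => (N ((offset g j.+1)%:R * h) w)%:R
     - (N ((offset g j + g j)%:R * h) w)%:R) @^-1` [set 1 : R].

(** For positive j, the left end of the cell carrying the previous mark. Block j thus ends at the
    left end of the cell of its own mark, where N has not yet jumped. *)
Definition block_time (g : nat -> nat) (j : nat) : nat :=
  if j is i.+1 then (offset g i + g i)%N else 0%N.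

Definition block (h : R) (g : nat -> nat) (j : nat) (w : T) : R :=
  D ((block_time g j.+1)%:R * h) w - D ((block_time g j)%:R * h) w.

(* The first block starts at time 0, the others at a mark. *)
Definition block_length (j g : nat) : nat := if j is 0%N then g else g.+1.

(** The endpoints of gaps and marked cells in one nondecreasing sequence: gaps start at even indices
    and marked cells at odd ones, so that independence of increments applies to all of them at
    once. *)
Let alternating (g : nat -> nat) (i : nat) : nat :=
  (offset g i./2 + (if odd i then g i./2 else 0))%N.

Let alternatingE g j : (alternating g j.*2 = offset g j) *
  (alternating g j.*2.+1 = offset g j + g j)%N.
Proof.
split; first by rewrite /alternating odd_double doubleK addn0.
by rewrite /alternating/= odd_double/= uphalf_double.
Qed.

Let alternating_le g i : (alternating g i <= alternating g i.+1)%N.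
Proof.
have [b [j ->]] : exists b j, i = (nat_of_bool b + j.*2)%N.
  by exists (odd i), i./2; rewrite odd_double_half.
case: b; last by rewrite add0n !alternatingE leq_addr.
by rewrite add1n -doubleS !alternatingE offsetS.
Qed.

Lemma probability_marks (h : R) (g : nat -> nat) (n : nat) : 0 < h ->
  P (\bigcap_(j < n) mark_event h g j) =
  (\prod_(j < n) (expR (- (lambda * h)) ^+ g j
                  * (lambda * h * expR (- (lambda * h)))))%:E.
Proof.
move=> h0; have [levyN lawN] := N_poisson.
pose tm i : R := (alternating g i)%:R * h.
pose B i : set R := [set (odd i)%:R].
have tm0 i : 0 <= tm i by rewrite mulr_ge0// ltW.
have tm_le i : tm i <= tm i.+1 by rewrite ler_pM2r// ler_nat.
have indep := levy_independent_increments levyN (tm0 0%N) tm_le.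
have mB i : measurable (B i) by exact: measurable_set1.
have := mutually_independent_ord n.*2 indep mB.
have -> : \bigcap_(i < n.*2) (fun w => (N (tm i.+1) w)%:R - (N (tm i) w)%:R)
    @^-1` B i = \bigcap_(j < n) mark_event h g j.
  apply/seteqP; split => w Hw.
    move=> j /= jn; split.
      have := Hw j.*2; rewrite /= ltn_double /B/tm !alternatingE odd_double/=.
      by apply.
    have := Hw j.*2.+1; rewrite /= ltn_Sdouble /B/tm -doubleS !alternatingE.
    by rewrite /= odd_double; apply.
  move=> i /= i2n; have [b [j ij]] : exists b j, i = (nat_of_bool b + j.*2)%N.
    by exists (odd i), i./2; rewrite odd_double_half.
  case: b ij => ij; rewrite {}ij ?add0n ?add1n in i2n *.
    rewrite ltn_Sdouble in i2n.
    rewrite /B/tm -doubleS !alternatingE /= odd_double.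
    exact: (Hw j i2n).2.
  rewrite ltn_double in i2n.
  rewrite /B/tm !alternatingE /= odd_double.
  exact: (Hw j i2n).1.
move=> ->.
elim: n => [|n IH]; first by rewrite double0 !big_ord0.
rewrite doubleS !big_ord_recr/= IH EFinM -muleA; congr (_ * _)%E.
rewrite /B/tm/= -doubleS !alternatingE odd_double/=.
have o0 k : 0 <= k%:R * h by rewrite mulr_ge0// ltW.
rewrite (poisson_increment0 N_poisson)//; last first.
  by rewrite ler_pM2r// ler_nat leq_addr.
rewrite (poisson_increment1 N_poisson)//; last by rewrite ltr_pM2r// ltr_nat offsetS.
rewrite -!EFinM; congr (_%:E); rewrite offsetS -!mulrBl -natrB ?leq_addr//.
rewrite -[X in X - _]natr1 [X in X - _]addrC addrK mul1r addKn.
rewrite -expRM_natl mulrN (mulrCA lambda (g n)%:R h); ring.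
Qed.

Lemma probability_blocks (h : R) (g : nat -> nat) (n : nat) (B : nat -> set R) :
  0 < h -> (forall j, measurable (B j)) ->
  P (\bigcap_(j < n) (block h g j @^-1` B j)) =
  (\prod_(j < n) P (D ((block_length j (g j))%:R * h) @^-1` B j))%E.
Proof.
move=> h0 mB; pose tm j : R := (block_time g j)%:R * h.
have tm0 j : 0 <= tm j by rewrite mulr_ge0// ltW.
have bt_le j : (block_time g j <= block_time g j.+1)%N.
  by case: j => // j; rewrite /block_time offsetS (leq_trans (leqnSn _))// leq_addr.
have tm_le j : tm j <= tm j.+1 by rewrite ler_pM2r// ler_nat.
have indep := levy_independent_increments D_levy (tm0 0%N) tm_le.
rewrite (mutually_independent_ord n indep mB); apply: eq_bigr => j _.
rewrite (levy_stationary_increments D_levy)//.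
rewrite /tm -mulrBl -natrB//; do 4 f_equal.
case: j => -[|j] _ /=; first by rewrite /offset big_ord0 subn0 !add0n.
by rewrite offsetS addSn subSn ?leq_addr// addKn.
Qed.

Lemma probability_gap_event (h : R) (g : nat -> nat) (n : nat) (B : nat -> set R) :
  0 < h -> (forall j, measurable (B j)) ->
  P (\bigcap_(j < n) mark_event h g j `&`
     \bigcap_(j < n) (block h g j @^-1` B j)) =
  (\prod_(j < n) ((expR (- (lambda * h)) ^+ g j
                  * (lambda * h * expR (- (lambda * h))))%:E *
     P (D ((block_length j (g j))%:R * h) @^-1` B j)))%E.
Proof.
move=> h0 mB; have o0 k : 0 <= k%:R * h by rewrite mulr_ge0// ltW.
rewrite ND_indep.
  rewrite probability_marks// probability_blocks// -prodEFin -big_split/=.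
  by [].
- apply: process_sigma_algebra_bigcap => j.
  pose G := [set A | exists t (B : set nat),
    [/\ 0 <= t, measurable B & A = N t @^-1` B]].
  apply: (@measurableI _ (g_sigma_algebraType G));
    exact: (@measurable_increment _ _ _ _ _ N (fun n : nat => n%:R : R)).
- apply: process_sigma_algebra_bigcap => j.
  exact: (@measurable_increment _ _ _ _ _ D id).
Qed.

End blocks.

(* Gaps are bounded by K to keep the sums finite. *)
Definition gap_fun (n K : nat) (g : {ffun 'I_n -> 'I_K}) (j : nat) : nat :=
  if insub j is Some i then g i else 0%N.

Lemma gap_funE (n K : nat) (g : {ffun 'I_n -> 'I_K}) (i : 'I_n) :
  gap_fun g i = g i.
Proof. by rewrite /gap_fun valK. Qed.

(** * Summation over all lists of gaps *)

Section gap_union.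
Context (d : measure_display) (T : measurableType d) (R : realType).
Variable P : probability T R.
Variables (D : R -> T -> R) (N : R -> T -> nat) (lambda : R) (O : set T).
Hypothesis D_levy : levy_process P D.
Hypothesis N_poisson : poisson_process P lambda N.
Hypothesis lambda_gt0 : 0 < lambda.
Hypothesis ND_indep : independent_processes P N D.
Hypothesis mO : measurable O.
Hypothesis PO : P O = 1%E.
Hypothesis N_le : forall w, O w -> forall s t, 0 <= s -> s <= t ->
  (N s w <= N t w)%N.

Lemma mark_eventP (h : R) (g : nat -> nat) (j : nat) (w : T) :
  mark_event N h g j w <->
  N ((offset g j + g j)%:R * h) w = N ((offset g j)%:R * h) w /\
  N ((offset g j.+1)%:R * h) w = (N ((offset g j + g j)%:R * h) w).+1.
Proof.
rewrite /mark_event; split=> [[/= /eqP + /eqP]|[/= -> ->]].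
  rewrite subr_eq0 eqr_nat => /eqP-> /=.
  by rewrite subr_eq nat1r eqr_nat => /eqP.
by rewrite subrr -natr1 [X in X - _]addrC addrK.
Qed.

Lemma marks_count (h : R) (g : nat -> nat) (n : nat) (w : T) : N 0 w = 0%N ->
  (forall j, (j < n)%N -> mark_event N h g j w) ->
  N ((offset g n)%:R * h) w = n.
Proof.
move=> N0; elim: n => [|n IH] marks; first by rewrite /offset big_ord0 mul0r.
have /mark_eventP[e ->] := marks n (ltnSn n); rewrite e IH// => j jn.
by apply: marks; exact: ltnW.
Qed.

(** At the first index where the gaps differ, both lists start from the same grid point, and the
    shorter gap puts a jump inside the stretch where the longer one forbids jumps. Monotonicity of
    [N] on [O] makes this a contradiction. *)
Lemma marks_inj (h : R) (g g' : nat -> nat) (n : nat) (w : T) : 0 < h -> O w ->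
  (forall j, (j < n)%N -> mark_event N h g j w) ->
  (forall j, (j < n)%N -> mark_event N h g' j w) ->
  forall j, (j < n)%N -> g j = g' j.
Proof.
move=> h0 Ow mg mg'; elim/ltn_ind => j IH jn.
have eo : offset g j = offset g' j.
  rewrite /offset; congr (_ + _)%N; apply: eq_bigr => i _.
  by apply: IH => //; exact: ltn_trans jn.
have absurd (f f' : nat -> nat) : (forall j, (j < n)%N -> mark_event N h f j w) ->
    (forall j, (j < n)%N -> mark_event N h f' j w) ->
    offset f j = offset f' j -> ~~ (f j < f' j)%N.
  move=> mf mf' ef; apply/negP => ff'.
  have [e1 e2] := (mark_eventP _ _ _ _).1 (mf _ jn).
  have [e1' _] := (mark_eventP _ _ _ _).1 (mf' _ jn).
  suff : (N ((offset f j.+1)%:R * h) w <= N ((offset f' j + f' j)%:R * h) w)%N.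
    by rewrite e2 e1 e1' ef ltnn.
  apply: N_le => //; first by rewrite mulr_ge0// ltW.
  by rewrite ler_pM2r// ler_nat offsetS ef ltn_add2l.
by apply/eqP; rewrite eqn_leq; apply/andP; split; rewrite leqNgt absurd.
Qed.

Definition gap_event (h : R) (g : nat -> nat) (n : nat) (B : nat -> set R) : set T :=
  \bigcap_(j < n) mark_event N h g j `&` \bigcap_(j < n) (block D h g j @^-1` B j).

(** Intersecting with [O] makes the union disjoint everywhere, not merely up to a null set. *)
Definition gap_union (h : R) (K n : nat) (B : nat -> set R) : set T :=
  \bigcup_(g in [set: {ffun 'I_n -> 'I_K}]) (gap_event h (gap_fun g) n B `&` O).

Let N_incr_measurable (s t x : R) : 0 <= s -> 0 <= t ->
  measurable ((fun w => (N t w)%:R - (N s w)%:R) @^-1` [set x]).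
Proof.
move=> s0 t0; rewrite -[_ @^-1` _]setTI.
have mN u : 0 <= u -> measurable_fun setT (fun w => (N u w)%:R : R).
  by move=> u0; exact: (levy_measurable N_poisson.1).
by apply: (measurable_funB (mN _ t0) (mN _ s0)) => //; exact: measurable_set1.
Qed.

Lemma measurable_gap_event (h : R) (g : nat -> nat) (n : nat) (B : nat -> set R) :
  0 < h -> (forall j, measurable (B j)) -> measurable (gap_event h g n B).
Proof.
move=> h0 mB; have t0 k : 0 <= k%:R * h by rewrite mulr_ge0// ltW.
apply: measurableI; apply: fin_bigcap_measurable; [exact: finite_II| |exact: finite_II|].
  by move=> j _; apply: measurableI; exact: N_incr_measurable.
move=> j _; rewrite -[_ @^-1` _]setTI.
by apply: (measurable_funB (levy_measurable D_levy (t0 _))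
  (levy_measurable D_levy (t0 _))).
Qed.

Lemma measurable_gap_union (h : R) (K n : nat) (B : nat -> set R) :
  0 < h -> (forall j, measurable (B j)) -> measurable (gap_union h K n B).
Proof.
move=> h0 mB; apply: fin_bigcup_measurable; first exact: finite_finset.
by move=> g _; apply: measurableI => //; exact: measurable_gap_event.
Qed.

(** The events are disjoint and each has a product probability, so distributivity turns the sum over
    gap functions into a product over blocks. Independence of the blocks is thus exact before any
    limit is taken. *)
Lemma probability_gap_union (h : R) (K n : nat) (B : nat -> set R) :
  0 < h -> (forall j, measurable (B j)) ->
  P (gap_union h K n B) = (\prod_(j < n) \sum_(g < K)
    expR (- (lambda * h)) ^+ g * (lambda * h * expR (- (lambda * h))) *
     fine (P (D ((block_length j g)%:R * h) @^-1` B j)))%:E.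
Proof.
move=> h0 mB; rewrite measure_fin_bigcup; last 3 first.
- exact: finite_finset.
- apply/trivIsetP => g g' _ _ gg'; apply/seteqP; split => // w.
  move=> [[[mg _] Ow] [[mg' _] _]]; move/eqP: gg'; apply.
  apply/ffunP => i; apply: val_inj => /=; rewrite -!gap_funE.
  exact: (marks_inj h0 Ow mg mg').
- by move=> g _; apply: measurableI => //; exact: measurable_gap_event.
have -> : [set: {ffun 'I_n -> 'I_K}] = [set` index_enum {ffun 'I_n -> 'I_K}].
  by apply/seteqP; split => g //= _; rewrite mem_index_enum.
rewrite -fsbig_seq ?index_enum_uniq// bigA_distr_bigA/= -sumEFin.
apply: eq_bigr => g _.
rewrite probability_setI1//; last exact: measurable_gap_event.
rewrite (probability_gap_event D_levy N_poisson)// -prodEFin; apply: eq_bigr => i _.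
rewrite gap_funE [in RHS]EFinM fineK// fin_num_measure//.
rewrite -[_ @^-1` _]setTI; apply: (levy_measurable D_levy) => //.
by rewrite mulr_ge0// ltW.
Qed.

End gap_union.

(** * Geometric sums as the grid is refined *)

Section scalars.
Context (R : realType) (lambda : R).
Hypothesis lambda_gt0 : 0 < lambda.

Lemma harmonic_lt (e : R) : 0 < e -> \forall k \near \oo, harmonic k < e.
Proof. by move=> e0; apply: cvgr_lt e0; exact: cvg_harmonic. Qed.

Lemma cvg_expR_harmonic : expR (- (lambda * harmonic k)) @[k --> \oo] --> (1 : R).
Proof.
have -> : (1 : R) = expR (- (lambda * 0)) by rewrite mulr0 oppr0 expR0.
apply: continuous_cvg; first exact: continuous_expR.
by apply: cvgN; apply: cvgM; [exact: cvg_cst|exact: cvg_harmonic].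
Qed.

Lemma cvg_expR_linear : expR (- (lambda * k.+1%:R)) @[k --> \oo] --> (0 : R).
Proof.
have c0 : lambda^-1 * harmonic k @[k --> \oo] --> (0 : R).
  by rewrite -(mulr0 lambda^-1); apply: cvgM; [exact: cvg_cst|exact: cvg_harmonic].
apply: (squeeze_cvgr _ (cvg_cst 0) c0); apply: nearW => k.
rewrite expR_ge0/= expRN -invfM lef_pV2 ?posrE ?expR_gt0 ?mulr_gt0//.
by rewrite (le_trans _ (expR_ge1Dx _))// lerDr.
Qed.

Lemma cvg_cell_mass :
  lambda * harmonic k * expR (- (lambda * harmonic k)) @[k --> \oo] --> (0 : R).
Proof.
rewrite -(mul0r 1); apply: cvgM; last exact: cvg_expR_harmonic.
by rewrite -(mulr0 lambda); apply: cvgM; [exact: cvg_cst|exact: cvg_harmonic].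
Qed.

(** A marked cell has mass x exp(-x), not 1 - exp(-x), so the weights are not exactly geometric.
    Both bounds come from exp(y) >= 1 + y, at y = -x for the lower one and at y = x for the upper
    one. *)
Lemma geometric_mass (x : R) (K : nat) : 0 < x ->
  expR (- x) * (1 - expR (- x) ^+ K)
  <= \sum_(g < K) expR (- x) ^+ g * (x * expR (- x)) <= 1.
Proof.
move=> x0; rewrite -mulr_suml; set q := expR (- x); set S := \sum_(g < K) _.
have q0 : 0 < q by exact: expR_gt0.
have SE : (1 - q) * S = 1 - q ^+ K by rewrite -[RHS]opprB subrX1 -mulNr opprB.
have q1 : 1 - q <= x by have := expR_ge1Dx (- x); rewrite -/q; lra.
have S0 : 0 <= S by apply: sumr_ge0 => i _; rewrite exprn_ge0// ltW.
have qE : q * expR x = 1 by rewrite -expRD addNr expR0.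
have q2 : x * q <= 1 - q.
  by have := expR_ge1Dx x; rewrite -(ler_pM2l q0) qE; lra.
have qK0 : 0 <= q ^+ K by rewrite exprn_ge0// ltW.
apply/andP; split.
  rewrite -SE; have : 0 <= x - (1 - q) by lra.
  by move=> /(mulr_ge0 (mulr_ge0 S0 (ltW q0))); lra.
by have := ler_wpM2l S0 q2; lra.
Qed.

(** (k+1)^2 cells of length 1/(k+1) span the time k+1; this is the probability of no jump up to
    then. *)
Lemma expR_harmonic_cells (k : nat) :
  expR (- (lambda * harmonic k)) ^+ (k.+1 ^ 2) = expR (- (lambda * k.+1%:R)).
Proof.
rewrite -expRM_natl; congr expR; rewrite mulrN; congr (- _).
by rewrite /harmonic/= natrX mulrCA expr2 mulfK ?pnatr_eq0.
Qed.

Lemma cvg_gap_mass : \sum_(g < k.+1 ^ 2) expR (- (lambda * harmonic k)) ^+ g *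
  (lambda * harmonic k * expR (- (lambda * harmonic k))) @[k --> \oo] --> (1 : R).
Proof.
have c1 : expR (- (lambda * harmonic k)) * (1 - expR (- (lambda * k.+1%:R)))
    @[k --> \oo] --> (1 * (1 - 0) : R).
  apply: cvgM; first exact: cvg_expR_harmonic.
  by apply: cvgB; [exact: cvg_cst|exact: cvg_expR_linear].
rewrite subr0 mul1r in c1.
have c2 : (1 : R) @[k --> \oo] --> (1 : R) by exact: cvg_cst.
apply: (squeeze_cvgr _ c1 c2); apply: nearW => k.
rewrite -expR_harmonic_cells; apply: geometric_mass.
by rewrite mulr_gt0// harmonic_gt0.
Qed.

Lemma cvg_prod_ord (f : nat -> nat -> R) (l : nat -> R) (n : nat) :
  (forall j, f j k @[k --> \oo] --> l j) ->
  \prod_(j < n) f j k @[k --> \oo] --> \prod_(j < n) l j.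
Proof.
move=> fl; elim: n => [|n IH].
  by under eq_fun do rewrite big_ord0; rewrite big_ord0; exact: cvg_cst.
under eq_fun do rewrite big_ord_recr/=; rewrite big_ord_recr/=.
exact: cvgM.
Qed.

Lemma cvg_gap_mass_exp (n : nat) : \prod_(j < n) \sum_(g < k.+1 ^ 2)
    expR (- (lambda * harmonic k)) ^+ g *
    (lambda * harmonic k * expR (- (lambda * harmonic k))) @[k --> \oo] --> (1 : R).
Proof.
have := @cvg_prod_ord _ (fun=> 1) n (fun=> cvg_gap_mass).
by rewrite big1_eq.
Qed.

End scalars.

(** * Almost sure properties of the Poisson paths *)

Section good_set.
Context (d : measure_display) (T : measurableType d) (R : realType).
Variable P : probability T R.
Variables (D : R -> T -> R) (N : R -> T -> nat) (lambda : R).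
Hypothesis D_levy : levy_process P D.
Hypothesis N_poisson : poisson_process P lambda N.
Hypothesis lambda_gt0 : 0 < lambda.
Hypothesis ND_indep : independent_processes P N D.

Lemma ae_forall_count (I : countType) (Q : I -> T -> Prop) :
  (forall i, {ae P, forall w, Q i w}) -> {ae P, forall w, forall i, Q i w}.
Proof.
move=> H; have : {ae P, forall w, forall n : nat,
    if @choice.unpickle I n is Some i then Q i w else True}.
  by apply: ae_foralln => n; case: choice.unpickle => [i|]; [exact: H|exact: aeW].
by apply: filterS => w Hw i; have := Hw (choice.pickle i); rewrite choice.pickleK.
Qed.

(** By stationarity N(t) - N(s) has the law of N(t - s), which is never negative. *)
Lemma poisson_ae_le (s t : R) : 0 <= s -> s <= t ->
  {ae P, forall w, (N s w <= N t w)%N}.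
Proof.
move=> s0 st; have [levyN _] := N_poisson.
have t0 := le_trans s0 st.
have mN u : 0 <= u -> measurable_fun setT (fun w => (N u w)%:R : R).
  by move=> u0; exact: (levy_measurable levyN).
exists ((fun w => (N t w)%:R - (N s w)%:R) @^-1` [set x : R | x < 0]).
have mneg : measurable [set x : R | x < 0].
  by rewrite -set_itvNyo; exact: measurable_itv.
split.
- rewrite -[_ @^-1` _]setTI.
  by apply: (measurable_funB (mN _ t0) (mN _ s0)).
- rewrite (levy_stationary_increments levyN s0 st)// (_ : _ @^-1` _ = set0)//.
  by apply/seteqP; split => w //=; rewrite ltNge ler0n.
- by move=> w /= /negP; rewrite -ltnNge subr_lt0 ltr_nat.
Qed.

Lemma nat_right_constant (x : R -> nat) (t : R) :
  ((x s)%:R : R) @[s --> t^'+] --> ((x t)%:R : R) ->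
  exists2 e : R, 0 < e & forall s, t < s -> s < t + e -> x s = x t.
Proof.
move=> /cvgrPdist_lt/(_ 1 ltr01)[e /= e0 He]; exists e => // s ts ste.
have := He s; rewrite /ball_/= => /(_ _ ts).
have -> : `|t - s| < e by rewrite ltr_norml; apply/andP; split; lra.
move=> /(_ isT); have [lt|lt|//] := ltngtP (x s) (x t).
  by move: lt; rewrite -(ler_nat R) -natr1 ltr_norml => ? /andP[? ?]; exfalso; lra.
by move: lt; rewrite -(ler_nat R) -natr1 ltr_norml => ? /andP[? ?]; exfalso; lra.
Qed.

Lemma poisson_paths : exists Om : set T, [/\ measurable Om, P Om = 1%E &
  forall w, Om w -> [/\ N 0 w = 0%N,
    forall s t, 0 <= s -> s <= t -> (N s w <= N t w)%N &
    forall t, 0 <= t -> exists2 u, t < u & (N u w <= N t w)%N]].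
Proof.
apply: ae_measurable_set; have [levyN _] := N_poisson.
(* A null set can be discarded for each of countably many pairs of times; right-continuity then
   carries monotonicity from rational to real times. *)
have : {ae P, forall w, forall q : rat * rat, 0 <= ratr q.1 :> R ->
    ratr q.1 <= ratr q.2 :> R -> (N (ratr q.1) w <= N (ratr q.2) w)%N}.
  apply: ae_forall_count => q.
  have [q0|q0] := boolP (0 <= ratr q.1 :> R); last exact: aeW.
  have [qq|qq] := boolP (ratr q.1 <= ratr q.2 :> R); last exact: aeW.
  by have := poisson_ae_le q0 qq; apply: filterS => w.
have := levy_start levyN; have := levy_cadlag levyN.
apply: filterS3 => w [right _] /eqP; rewrite (eqr_nat R _ 0) => /eqP N0 mono.
split => // [s t s0|t t0]; last first.
  have [e e0 He] := nat_right_constant (right t t0).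
  by exists (t + e / 2); [lra|rewrite He//; lra].
rewrite le_eqVlt => /predU1P[->//|st].
have [e e0 He] := nat_right_constant (right s s0).
have [f f0 Hf] := nat_right_constant (right t (le_trans s0 (ltW st))).
have /rat_in_itvoo[p] : s < Num.min t (s + e) by rewrite lt_min st/=; lra.
rewrite in_itv/= lt_min => /and3P[sp pt pe].
have /rat_in_itvoo[q] : t < t + f by lra.
rewrite in_itv/= => /andP[tq qf].
by have := mono (p, q); rewrite /= (He (ratr p))// (Hf (ratr q))//; apply; lra.
Qed.

Lemma poisson_good_paths : exists Om : set T, [/\ measurable Om, P Om = 1%E &
  forall w, Om w -> [/\ N 0 w = 0%N,
    forall s t, 0 <= s -> s <= t -> (N s w <= N t w)%N,
    forall t, 0 <= t -> exists2 u, t < u & (N u w <= N t w)%N &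
    forall n, exists2 t, 0 <= t & (n <= N t w)%N]].
Proof.
have [Om [mO PO Opath]] := poisson_paths.
have leO w : Om w -> forall s t, 0 <= s -> s <= t -> (N s w <= N t w)%N.
  by move=> /Opath[].
pose U n := \bigcup_k (N k%:R @^-1` [set m | (n <= m)%N]).
have mU n : measurable (U n).
  apply: bigcup_measurable => k _.
  have [levyN _] := N_poisson.
  rewrite (_ : _ @^-1` _ = [set: T] `&`
      (fun w => (N k%:R w)%:R) @^-1` `[(n%:R : R), +oo[%classic); last first.
    by rewrite setTI; apply/seteqP; split => w /=; rewrite in_itv/= andbT ler_nat.
  by apply: (levy_measurable levyN).
have PU n : P (U n) = 1%E.
  apply/eqP; rewrite eq_le probability_le1//=.
  (* Unboundedness of N reuses the grid: n marks force N to reach n, and with [setT] as the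
     condition on every block the marks exist with probability tending to 1. *)
  pose c k : R := \prod_(j < n) \sum_(g < k.+1 ^ 2)
    expR (- (lambda * harmonic k)) ^+ g *
      (lambda * harmonic k * expR (- (lambda * harmonic k))).
  apply: (@probability_ge_limsup _ _ _ P _
    (fun k => gap_union D N Om (harmonic k) (k.+1 ^ 2) n (fun=> setT)) c) => //.
  - by move=> k; apply: (measurable_gap_union D_levy N_poisson mO) => //; exact: harmonic_gt0.
  - move=> w Uw; apply: nearW => k [g _ [[marks _] Ow]]; apply: Uw.
    have [N0 _ _] := Opath w Ow.
    set x : R := (offset (gap_fun g) n)%:R * harmonic k.
    have x0 : 0 <= x by rewrite mulr_ge0// harmonic_ge0.
    exists (Num.truncn x).+1 => //=.
    have -> : n = N x w by rewrite (marks_count N0).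
    by apply: leO => //; exact/ltW/truncnS_gt.
  - move=> k; rewrite (probability_gap_union D_levy N_poisson lambda_gt0 ND_indep mO PO leO)
      ?harmonic_gt0//.
    rewrite lee_fin /c le_eqVlt; apply/predU1P; left.
    apply: eq_bigr => j _; apply: eq_bigr => g _.
    by rewrite preimage_setT probability_setT mulr1.
  - exact: cvg_gap_mass_exp.
pose V := \bigcap_n U n.
have mV : measurable V by apply: bigcapT_measurable.
have PV : P V = 1%E by exact: probability_bigcap1.
exists (Om `&` V); split; first exact: measurableI.
  by rewrite setIC probability_setI1.
move=> w [Ow Vw]; have [N0 Nle Nright] := Opath w Ow; split => // n.
by have [k _ /= nk] := Vw n I; exists k%:R.
Qed.

End good_set.

(** * Almost sure properties of the subordinator paths *)

Section subordinator.
Context (d : measure_display) (T : measurableType d) (R : realType).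
Variable P : probability T R.
Variables (D : R -> T -> R) (a : R).
Hypothesis D_levy : levy_process P D.
Hypothesis D_incr : strictly_increasing_paths P D.
Hypothesis D_laplace : forall t : R, 0 <= t ->
  ('E_P[fun w => expR (- D t w)%R] = (expR (- (t * a))%R)%:E)%E.

Let mexpD t : 0 <= t -> measurable_fun setT (fun w => expR (- D t w)).
Proof.
move=> t0; apply: measurableT_comp => //; apply: measurable_funN.
exact: (levy_measurable D_levy).
Qed.

Let ae_pos : {ae P, forall w, 0 < D 1 w}.
Proof.
have := levy_start D_levy; have := D_incr.
by apply: filterS2 => w Dw D0; rewrite -[X in X < _]D0; apply: Dw.
Qed.

(** Otherwise exp(-D(1)) would have expectation at least 1 while being less than 1 almost surely. *)
Lemma laplace_exponent_gt0 : 0 < a.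
Proof.
rewrite ltNge; apply/negP => a0.
(* Truncation at 0 makes [g] at most 1 everywhere, so 1 - g is a nonnegative integrand; [g] equals
   exp(-D(1)) almost surely. *)
pose g w := expR (- Num.max 0 (D 1 w)).
have mg : measurable_fun setT g.
  apply: measurableT_comp => //; apply: measurable_funN.
  by apply: measurable_maxr => //; exact: (levy_measurable D_levy).
have g1 w : g w <= 1 by rewrite -expR0 ler_expR oppr_le0 le_max lexx.
have intg : (\int[P]_w (g w)%:E = (expR (- a))%:E)%E.
  rewrite -[X in - X]mul1r -D_laplace// unlock; apply: ae_eq_integral => //.
  - exact/measurable_EFinP.
  - by apply/measurable_EFinP; exact: mexpD.
  - by have := ae_pos; apply: filterS => w w0 _; rewrite /g max_r// ltW.
have int1 : (\int[P]_w (1 - g w)%:E + \int[P]_w (g w)%:E = 1)%E.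
  rewrite -ge0_integralD//; last 4 first.
  - by move=> w _; rewrite lee_fin subr_ge0.
  - by apply/measurable_EFinP; exact: measurable_funB.
  - by move=> w _; rewrite lee_fin expR_ge0.
  - exact/measurable_EFinP.
  under eq_integral do rewrite -EFinD subrK.
  by rewrite integral_cst// mul1e; exact: probability_setT.
have int0 : (\int[P]_w `|(1 - g w)%:E| = 0)%E.
  under eq_integral do rewrite gee0_abs ?lee_fin ?subr_ge0//.
  apply/eqP; rewrite eq_le integral_ge0 ?andbT; last first.
    by move=> w _; rewrite lee_fin subr_ge0.
  move: int1; rewrite intg => int1; rewrite leNgt; apply/negP => u0.
  have : (1 < \int[P]_w (1 - g w)%:E + (expR (- a))%:E)%E.
    rewrite -[X in (X < _)%E]add0e lte_leD//.
    by rewrite lee_fin -expR0 ler_expR oppr_ge0.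
  by rewrite int1 ltxx.
have : {ae P, forall w, False}.
  have mu : measurable_fun setT (fun w => (1 - g w)%:E).
    by apply/measurable_EFinP; exact: measurable_funB.
  have /(ae_eq_integral_abs P measurableT mu) ae0 := int0.
  have := ae_pos; have := ae0; apply: filterS2 => w /(_ I)[] /eqP + w0.
  rewrite subr_eq0 eq_sym => /eqP gw1.
  have : g w < 1 by rewrite -expR0 ltr_expR oppr_lt0 lt_max w0 orbT.
  by rewrite gw1 ltxx.
move=> /ae_measurable_set[A [_ PA FA]].
have A0 : A = set0 by apply/seteqP; split => // w /FA.
by move: PA; rewrite A0 measure0 => /eqP; rewrite eq_sym onee_eq0.
Qed.

Lemma subordinator_paths : exists Om : set T, [/\ measurable Om, P Om = 1%E &
  forall w, Om w -> [/\ D 0 w = 0,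
    forall s t, 0 <= s -> s < t -> D s w < D t w &
    forall x, exists2 t, 0 <= t & x < D t w]].
Proof.
have [A [mA PA Apath]] : exists A : set T, [/\ measurable A, P A = 1%E &
    forall w, A w -> D 0 w = 0 /\ forall s t, 0 <= s -> s < t -> D s w < D t w].
  apply: ae_measurable_set; have := levy_start D_levy; have := D_incr.
  by apply: filterS2.
pose U (n : nat) := \bigcup_k [set w | n%:R < D k.+1%:R w].
have mDn (n k : nat) : measurable [set w | n%:R < D k.+1%:R w].
  rewrite (_ : [set _ | _] = [set: T] `&` D k.+1%:R @^-1` `](n%:R : R), +oo[%classic).
    exact: (levy_measurable D_levy).
  by rewrite setTI; apply/seteqP; split => w /=; rewrite in_itv/= andbT.
have mU n : measurable (U n) by apply: bigcup_measurable.
have PU n : P (U n) = 1%E.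
  apply/eqP; rewrite eq_le probability_le1//=.
  (* Markov's inequality for exp(-D(k+1)) gives P(D(k+1) <= n) <= exp(n) exp(-a(k+1)), which tends
     to 0 since a > 0. *)
  apply: (@probability_ge_limsup _ _ _ P _
    (fun k => [set w | n%:R < D k.+1%:R w])
    (fun k => 1 - expR n%:R * expR (- (a * k.+1%:R)))) => //.
  - by move=> w Uw; apply: nearW => k nk; apply: Uw; exists k.
  - move=> k.
    have mk : measurable_fun setT (fun w => (expR (- D k.+1%:R w))%:E).
      by apply/measurable_EFinP; exact: mexpD.
    have := le_integral_abse P measurableT mk (expR_gt0 (- n%:R)).
    have -> : (\int[P]_w `|(expR (- D k.+1%:R w))%:E|
        = (expR (- (a * k.+1%:R)))%:E)%E.
      rewrite mulrC -D_laplace// unlock; apply: eq_integral => w _.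
      by rewrite gee0_abs ?lee_fin ?expR_ge0.
    rewrite setTI.
    have -> : [set w | ((expR (- n%:R))%:E <= `|(expR (- D k.+1%:R w))%:E|)%E]
        = ~` [set w | n%:R < D k.+1%:R w].
      apply/seteqP; split => w /=; rewrite ger0_norm ?expR_ge0// lee_fin.
        by rewrite ler_expR lerN2 => /le_gtF ->.
      by move=> /negP; rewrite -leNgt ler_expR lerN2.
    rewrite [X in (_ * X)%E](_ : _ = 1 - P [set w | (n%:R < D k.+1%:R w)%R])%E; last first.
      exact: probability_setC.
    have -> : P [set w | n%:R < D k.+1%:R w]
        = (fine (P [set w | n%:R < D k.+1%:R w]))%:E.
      by rewrite fineK// fin_num_measure.
    set p := fine _; rewrite -EFinB -EFinM !lee_fin.
    rewrite -(ler_pM2l (expR_gt0 n%:R)) mulrA -(expRD n%:R (- n%:R)) subrr expR0; lra.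
  - have lim1 : 1 - expR n%:R * expR (- (a * k.+1%:R)) @[k --> \oo]
        --> (1 - expR n%:R * 0 : R).
      apply: cvgB; first exact: cvg_cst.
      by apply: cvgM; [exact: cvg_cst|exact: (cvg_expR_linear laplace_exponent_gt0)].
    by rewrite mulr0 subr0 in lim1.
pose V := \bigcap_n U n.
have mV : measurable V by apply: bigcapT_measurable.
have PV : P V = 1%E by exact: probability_bigcap1.
exists (A `&` V); split; first exact: measurableI.
  by rewrite setIC probability_setI1.
move=> w [Aw Vw]; have [D0 Dlt] := Apath w Aw; split => // x.
have [k _ /= nk] := Vw (Num.truncn x).+1 I; exists k.+1%:R => //.
by apply: lt_trans nk; exact: truncnS_gt.
Qed.

End subordinator.

(** * Joint tails of the waiting times *)

Section renewal_limit.
Context (d : measure_display) (T : measurableType d) (R : realType).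
Variable P : probability T R.
Variables (D : R -> T -> R) (N : R -> T -> nat) (lambda : R) (Om : set T).
Hypothesis D_levy : levy_process P D.
Hypothesis N_poisson : poisson_process P lambda N.
Hypothesis lambda_gt0 : 0 < lambda.
Hypothesis ND_indep : independent_processes P N D.
Hypothesis mOm : measurable Om.
Hypothesis POm : P Om = 1%E.
Hypothesis Om_good : forall w, Om w -> good_path D N w.

Let N_le w : Om w -> forall s t, 0 <= s -> s <= t -> (N s w <= N t w)%N.
Proof. by move=> /Om_good/good_N_le. Qed.

Definition passage_on (n : nat) : T -> R := passage D N n \_ Om.

Lemma passage_onE n w : Om w -> passage_on n w = passage D N n w.
Proof. by move=> Ow; rewrite /passage_on patchE mem_set. Qed.

Lemma passage_on_out n w : ~ Om w -> passage_on n w = 0.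
Proof. by move=> Ow; rewrite /passage_on patchE memNset. Qed.

Let measurable_D_gt (t x : R) : 0 <= t -> measurable [set w | x < D t w].
Proof.
move=> t0; rewrite (_ : [set _ | _] = [set: T] `&` D t @^-1` `]x, +oo[%classic).
  exact: (levy_measurable D_levy).
by rewrite setTI; apply/seteqP; split => w /=; rewrite in_itv/= andbT.
Qed.

Let measurable_N_lt (t : R) (n : nat) : 0 <= t -> measurable [set w | (N t w < n)%N].
Proof.
move=> t0; rewrite (_ : [set _ | _] = [set: T] `&`
    (fun w => (N t w)%:R) @^-1` `]-oo, (n%:R : R)[%classic).
  by apply: (levy_measurable N_poisson.1).
by rewrite setTI; apply/seteqP; split => w /=; rewrite in_itv/= ltr_nat.
Qed.

Lemma measurable_passage_on n : measurable_fun setT (passage_on n).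
Proof.
case: n => [|n].
  rewrite (_ : passage_on 0 = cst 0); first exact: measurable_cst.
  apply/funext => w; have [Ow|Ow] := pselect (Om w).
    by rewrite passage_onE// passage0.
  by rewrite passage_on_out.
apply: (measurability (@RGenOInfty.G R)); first exact: RGenOInfty.measurableE.
move=> _ [_ [x ->] <-]; rewrite setTI.
pose U := \bigcup_(q : rat)
  [set w | [/\ 0 <= ratr q :> R, (N (ratr q) w < n.+1)%N & x < D (ratr q) w]].
have mU : measurable U.
  apply: bigcupT_measurable_rat => q; have [q0|q0] := boolP (0 <= ratr q :> R).
    rewrite (_ : [set _ | _] =
      [set w | (N (ratr q) w < n.+1)%N] `&` [set w | x < D (ratr q) w]).
      by apply: measurableI; [exact: measurable_N_lt|exact: measurable_D_gt].
    by apply/seteqP; split => w /= [].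
  by rewrite (_ : [set _ | _] = set0)//; apply/seteqP; split => // w [].
have -> : passage_on n.+1 @^-1` `]x, +oo[%classic =
    (Om `&` U) `|` (~` Om `&` [set w | x < 0]).
  apply/seteqP; split => w /=; rewrite in_itv/= andbT.
    have [Ow|Ow] := pselect (Om w); last by rewrite passage_on_out//; right.
    rewrite passage_onE// => /(lt_passage_rat (Om_good Ow))[q qP].
    by left; split => //; exists q.
  move=> [[Ow [q _ qP]]|[Ow x0]]; last by rewrite passage_on_out.
  by rewrite passage_onE//; apply/(lt_passage_rat (Om_good Ow)); exists q.
apply: measurableU; apply: measurableI => //; first exact: measurableC.
by have [x0|x0] := boolP (x < 0);
  [rewrite (_ : [set _ | _] = setT)//; apply/seteqP; split
  |rewrite (_ : [set _ | _] = set0)//; apply/seteqP; split => // w].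
Qed.

Definition interarrival (n : nat) (w : T) : R :=
  passage_on n.+1 w - passage_on n w.

Lemma measurable_interarrival n : measurable_fun setT (interarrival n).
Proof. by apply: measurable_funB; exact: measurable_passage_on. Qed.

Lemma interarrival_ge0 n w : 0 <= interarrival n w.
Proof.
rewrite /interarrival; have [Ow|Ow] := pselect (Om w).
  by rewrite !passage_onE// subr_ge0; apply: passage_le => //; exact: Om_good.
by rewrite !passage_on_out// subrr.
Qed.

Let mark_position h g j : (offset g j.+1)%:R * h = (offset g j + g j)%:R * h + h :> R.
Proof. by rewrite offsetS -natr1 mulrDl mul1r. Qed.

(** The left ends of the marked cells approach the passage values by [passage_near]. The bound [del]
    depends on the path but not on the list of gaps. *)
Lemma block_near (w : T) (n : nat) (e : nat -> R) : Om w -> (forall j, 0 < e j) ->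
  exists2 del : R, 0 < del & forall h g, 0 < h -> h < del ->
    (forall j, (j < n)%N -> mark_event N h g j w) ->
    forall j, (j < n)%N -> `|block D h g j w - interarrival j w| < e j.
Proof.
move=> Ow e0; have good := Om_good Ow.
have marks_near (f : nat -> R) : (forall j, 0 < f j) ->
    exists2 del : R, 0 < del & forall h g, 0 < h -> h < del ->
      (forall j, (j < n)%N -> mark_event N h g j w) ->
      forall j, (j < n)%N ->
        passage D N j.+1 w - f j < D ((offset g j + g j)%:R * h) w
          <= passage D N j.+1 w.
  move=> f0; elim: n => [|n [del del0 IH]]; first by exists 1.
  have [del' del'0 H] := passage_near good n (f0 n).
  exists (Num.min del del'); first by rewrite lt_min del0.
  move=> h g h0; rewrite lt_min => /andP[hd hd'] marks j.
  rewrite ltnS leq_eqVlt => /predU1P[->|jn]; last first.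
    by apply: IH => // i im; apply: marks; exact: ltnW.
  have count m : (m <= n.+1)%N -> N ((offset g m)%:R * h) w = m.
    move=> mn; apply: marks_count; first exact: good_N0 good.
    by move=> i im; apply: marks; exact: leq_trans mn.
  have [e1 e2] := (mark_eventP _ _ _ _ _).1 (marks n (ltnSn n)).
  apply: H hd' _ _ => //; first by rewrite mulr_ge0// ltW.
    by rewrite e1 count.
  by rewrite -mark_position count.
(* An endpoint is shared by blocks j and j+1, hence the minimum. All endpoint errors have the same
   sign, so the error of a block is at most the larger of its two endpoint errors. *)
pose f j := Num.min (e j) (e j.+1).
have f0 j : 0 < f j by rewrite lt_min !e0.
have [del del0 H] := marks_near f f0; exists del => // h g h0 hd marks j jn.
rewrite /interarrival !passage_onE//.
have /andP[lo up] := H h g h0 hd marks j jn.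
have fj : f j <= e j by rewrite ge_min lexx.
rewrite ltr_norml; case: j => [|j] in jn lo up fj *.
  rewrite /block/= mul0r passage0 !subr0 (good_D0 good) subr0.
  by apply/andP; split; have := f0 0%N; lra.
have /andP[lo' up'] := H h g h0 hd marks j (ltnW jn).
have fj' : f j <= e j.+1 by rewrite ge_min lexx orbT.
by rewrite /block; apply/andP; split; have := f0 j; lra.
Qed.

Let ray (t : nat -> R) (j : nat) : set R := `]t j, +oo[%classic.

Let A n t k := gap_union D N Om (harmonic k) (k.+1 ^ 2) n (ray t).
(** With no condition on D, this says that the n marks exist within the allowed gaps. *)
Let Full n k := gap_union D N Om (harmonic k) (k.+1 ^ 2) n (fun=> setT).

Let mA n t k : measurable (A n t k).
Proof.
apply: (measurable_gap_union D_levy N_poisson mOm); first exact: harmonic_gt0.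
by move=> j; exact: measurable_itv.
Qed.

Let mFull n k : measurable (Full n k).
Proof.
by apply: (measurable_gap_union D_levy N_poisson mOm); first exact: harmonic_gt0.
Qed.

Let cell (j : nat) (x : R) (k : nat) : R := \sum_(g < k.+1 ^ 2)
  expR (- (lambda * harmonic k)) ^+ g
  * (lambda * harmonic k * expR (- (lambda * harmonic k)))
  * fine (P (D ((block_length j g)%:R * harmonic k) @^-1` `]x, +oo[%classic)).

Let PA n t k : P (A n t k) = (\prod_(j < n) cell j (t j) k)%:E.
Proof.
rewrite (probability_gap_union D_levy N_poisson lambda_gt0 ND_indep mOm POm N_le)//.
  exact: harmonic_gt0.
by move=> j; exact: measurable_itv.
Qed.

Let PFull n : fine (P (Full n k)) @[k --> \oo] --> (1 : R).
Proof.
have FE k : fine (P (Full n k)) = \prod_(j < n) \sum_(g < k.+1 ^ 2)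
    expR (- (lambda * harmonic k)) ^+ g
    * (lambda * harmonic k * expR (- (lambda * harmonic k))).
  rewrite (probability_gap_union D_levy N_poisson lambda_gt0 ND_indep mOm POm N_le)
    ?harmonic_gt0//=.
  apply: eq_bigr => j _; apply: eq_bigr => g _.
  by rewrite preimage_setT probability_setT mulr1.
under eq_fun do rewrite FE.
exact: cvg_gap_mass_exp.
Qed.

Let PB n t k : (P (A n t k `|` ~` Full n k)
  <= P (A n t k) + (1 - fine (P (Full n k)))%:E)%E.
Proof.
have <- : P (~` Full n k) = (1 - fine (P (Full n k)))%:E.
  by rewrite probability_setC// EFinB fineK// fin_num_measure.
by apply: measureU2 => //; exact: measurableC.
Qed.

Let PB0 n : 1 - fine (P (Full n k)) @[k --> \oo] --> (0 : R).
Proof. by rewrite -(subrr 1); apply: cvgB; [exact: cvg_cst|exact: PFull]. Qed.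

Let above n t := Om `&` \bigcap_(j < n) [set w | t j < interarrival j w].

Let minter_gt j x : measurable [set w | x < interarrival j w].
Proof.
rewrite (_ : [set _ | _] = [set: T] `&` interarrival j @^-1` `]x, +oo[%classic).
  by apply: measurable_interarrival.
by rewrite setTI; apply/seteqP; split => w /=; rewrite in_itv/= andbT.
Qed.

Let mabove n t : measurable (above n t).
Proof.
apply: measurableI => //; apply: fin_bigcap_measurable; first exact: finite_II.
by move=> j _; exact: minter_gt.
Qed.

Let above_liminf n t w : above n t w ->
  \forall k \near \oo, (A n t k `|` ~` Full n k) w.
Proof.
move=> [Ow Jt]; pose e j := if (j < n)%N then interarrival j w - t j else 1.
have e0 j : 0 < e j by rewrite /e; case: ifPn => // jn; rewrite subr_gt0; exact: Jt.
have [del del0 H] := block_near n Ow e0.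
near=> k; have [[g _ [[marks _] _]]|nF] := pselect (Full n k w); last by right.
have hd : harmonic k < del by near: k; exact: harmonic_lt.
left; exists g => //; split => //; split => // j jn.
suff : t j < block D (harmonic k) (gap_fun g) j w.
  by rewrite /ray/= in_itv/= andbT.
have := H (harmonic k) (gap_fun g) (harmonic_gt0 k) hd marks j jn.
by rewrite ltr_norml /e jn => /andP[? _]; lra.
Unshelve. all: by end_near. Qed.

Let limsup_above n t w : ~ (Om `&` \bigcap_(j < n) [set w | t j <= interarrival j w]) w ->
  \forall k \near \oo, ~ A n t k w.
Proof.
have [Ow|Ow] := pselect (Om w); last by move=> _; apply: nearW => k [g _ []].
move=> nJ; have [j [jn Jt]] : exists j, (j < n)%N /\ interarrival j w < t j.
  apply: contrapT => H; apply: nJ; split => // j /= jn; rewrite leNgt.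
  by apply/negP => Jt; apply: H; exists j.
have e0 (i : nat) : 0 < t j - interarrival j w by rewrite subr_gt0.
have [del del0 H] := block_near n Ow e0.
near=> k => -[g _ [[marks blocks] _]].
have Dt : t j < block D (harmonic k) (gap_fun g) j w.
  by have := blocks j jn; rewrite /ray/= in_itv/= andbT.
have hd : harmonic k < del by near: k; exact: harmonic_lt.
have := H (harmonic k) (gap_fun g) (harmonic_gt0 k) hd marks j jn.
by rewrite ltr_norml ltrD2r [X in _ && X]ltNge (ltW Dt) andbF.
Unshelve. all: by end_near. Qed.

Definition interarrival_tail (x : R) : R :=
  fine (P [set w | x < interarrival 0 w]).

Let P_Om (X : set T) : measurable X -> P (Om `&` X) = P X.
Proof. by move=> mX; rewrite setIC probability_setI1. Qed.

(** The first block starts at D(0) = 0 and ends at a time with N = 0, so it is at most tau_1 and the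
    grid event lies inside the limit event. *)
Let cell0_cvg x : cell 0 x k @[k --> \oo] --> interarrival_tail x.
Proof.
pose t := fun _ : nat => x.
have -> : cell 0 x = (fun k => fine (P (A 1 t k))).
  by apply/funext => k; rewrite PA big_ord_recl big_ord0 mulr1.
have -> : interarrival_tail x = fine (P (above 1 t)).
  rewrite P_Om; first by rewrite II1 bigcap_set1.
  by apply: fin_bigcap_measurable => [|j _]; [exact: finite_II|exact: minter_gt].
apply: (probability_cvg_inner (mabove 1 t) (mA 1 t)
  (B := fun k => A 1 t k `|` ~` Full 1 k) _ _ _ (PB 1 t) (PB0 1)).
- by move=> k; apply: measurableU => //; exact: measurableC.
- exact: above_liminf.
- move=> k w [g _ [[marks blocks] Ow]]; have good := Om_good Ow; split => //.
  rewrite II1 bigcap_set1/=; have := blocks 0%N (ltnSn 0).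
  have [e1 _] := (mark_eventP _ _ _ _ _).1 (marks 0%N (ltnSn 0)).
  rewrite /ray/= in_itv/= andbT /block/= mul0r (good_D0 good) subr0 => xD.
  rewrite /interarrival !passage_onE// passage0 subr0; apply: lt_le_trans xD _.
  apply: (le_passage good); first by rewrite mulr_ge0// harmonic_ge0.
  by rewrite e1 /offset big_ord0 mul0r (good_N0 good).
Qed.

(* The law of the other blocks is that of the first one conditioned on a positive
   length, and the probability of a zero length tends to 0. *)
Let cell_cvg j x : cell j x k @[k --> \oo] --> interarrival_tail x.
Proof.
case: j => [|j]; first exact: cell0_cvg.
pose q k := expR (- (lambda * harmonic k)) : R.
pose p k := lambda * harmonic k * q k.
pose f k g := fine (P (D (g%:R * harmonic k) @^-1` `]x, +oo[%classic)).
have f01 k g : 0 <= f k g <= 1.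
  have mDg : measurable (D (g%:R * harmonic k) @^-1` `]x, +oo[%classic).
    rewrite -[_ @^-1` _]setTI; apply: (levy_measurable D_levy) => //.
    by rewrite mulr_ge0// harmonic_ge0.
  by rewrite fine_ge0//= -lee_fin fineK ?fin_num_measure// probability_le1.
have p0 k : 0 <= p k.
  by rewrite mulr_ge0 ?expR_ge0// mulr_ge0 ?harmonic_ge0// ltW.
have q01 k : 0 < q k <= 1.
  by rewrite expR_gt0/= -expR0 ler_expR oppr_le0 mulr_ge0 ?harmonic_ge0// ltW.
(* Shifting the summation index by one matches blocks of length g+1 with first blocks; only the end
   terms g = 0 and g = (k+1)^2 differ, and each is at most [p k]. *)
have shift k : p k * f k 0%N + q k * cell j.+1 x k
    = cell 0 x k + q k ^+ (k.+1 ^ 2) * p k * f k (k.+1 ^ 2)%N.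
  have -> : cell 0 x k + q k ^+ (k.+1 ^ 2) * p k * f k (k.+1 ^ 2)%N
      = \sum_(g < (k.+1 ^ 2).+1) q k ^+ g * p k * f k g.
    by rewrite big_ord_recr.
  rewrite big_ord_recl/= expr0 mul1r; congr (_ + _).
  rewrite /cell mulr_sumr; apply: eq_bigr => g _.
  by rewrite /bump/= exprS !mulrA.
have pcvg : p k @[k --> \oo] --> (0 : R) by exact: cvg_cell_mass.
have qc : q k * cell j.+1 x k @[k --> \oo] --> interarrival_tail x.
  have l1 : cell 0 x k - p k @[k --> \oo] --> interarrival_tail x.
    by rewrite -[X in _ --> X]subr0; apply: cvgB => //; exact: cell0_cvg.
  have l2 : cell 0 x k + p k @[k --> \oo] --> interarrival_tail x.
    by rewrite -[X in _ --> X]addr0; apply: cvgD => //; exact: cell0_cvg.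
  apply: (squeeze_cvgr _ l1 l2); apply: nearW => k.
  have /andP[f0 f1] := f01 k 0%N; have /andP[g0 g1] := f01 k (k.+1 ^ 2)%N.
  have /andP[/ltW q0 q1] := q01 k.
  have qK0 : 0 <= q k ^+ (k.+1 ^ 2) by rewrite exprn_ge0.
  have qK1 : q k ^+ (k.+1 ^ 2) <= 1 by rewrite exprn_ile1.
  have u1 : 0 <= p k * f k 0%N <= p k by rewrite mulr_ge0//= ler_piMr.
  have u2 : 0 <= q k ^+ (k.+1 ^ 2) * p k * f k (k.+1 ^ 2)%N <= p k.
    rewrite mulr_ge0//=; last by rewrite mulr_ge0.
    apply: le_trans (ler_piMr _ g1) _; first by rewrite mulr_ge0.
    by rewrite ler_piMl.
  by have := shift k; move: u1 u2 => /andP[? ?] /andP[? ?] ?; apply/andP; split; lra.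
have qV : (q k)^-1 @[k --> \oo] --> (1 : R).
  by rewrite -[X in _ --> X]invr1; apply: cvgV => //; exact: cvg_expR_harmonic.
rewrite -[X in _ --> X]mul1r.
have -> : cell j.+1 x = fun k => (q k)^-1 * (q k * cell j.+1 x k).
  apply/funext => k; rewrite mulKf//; have /andP[q0 _] := q01 k.
  by rewrite gt_eqF.
exact: cvgM.
Qed.

Let tail_prod_cvg (n : nat) (t : nat -> R) :
  \prod_(j < n) cell j (t j) k @[k --> \oo] --> \prod_(j < n) interarrival_tail (t j).
Proof.
exact: (cvg_prod_ord (fun j => @cell_cvg j (t j))).
Qed.

Let tail_right_continuous x :
  interarrival_tail (x + harmonic k) @[k --> \oo] --> interarrival_tail x.
Proof.
apply: (probability_cvg_inner _ _ _ _ (e := fun=> 0)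
  (B := fun k => [set w | x + harmonic k < interarrival 0 w])) => //.
- move=> w /= xJ; near=> k; rewrite -ltrBrDl; near: k; apply: harmonic_lt.
  by rewrite subr_gt0.
- by move=> k w /=; apply: lt_trans; rewrite ltrDl harmonic_gt0.
- by move=> k; rewrite adde0.
- exact: cvg_cst.
Unshelve. all: by end_near. Qed.

Lemma interarrival_joint_tail (n : nat) (t : nat -> R) :
  P (\bigcap_(j < n) [set w | t j < interarrival j w])
  = (\prod_(j < n) interarrival_tail (t j))%:E.
Proof.
have mcap (u : nat -> R) : measurable (\bigcap_(j < n) [set w | u j < interarrival j w]).
  by apply: fin_bigcap_measurable => [|j _]; [exact: finite_II|exact: minter_gt].
rewrite -P_Om//; apply/eqP; rewrite eq_le; apply/andP; split.
  have cB : \prod_(j < n) cell j (t j) k + (1 - fine (P (Full n k)))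
      @[k --> \oo] --> \prod_(j < n) interarrival_tail (t j).
    by rewrite -[X in _ --> X]addr0; apply: cvgD => //; exact: tail_prod_cvg.
  apply: (probability_le_liminf (mabove n t) _ (@above_liminf n t) _ cB).
    by move=> k; apply: measurableU => //; exact: measurableC.
  by move=> k; rewrite EFinD -PA; exact: PB.
have ge_tail (u : nat -> R) : ((\prod_(j < n) interarrival_tail (u j))%:E
    <= P (Om `&` \bigcap_(j < n) [set w | (u j <= interarrival j w)%R]))%E.
  apply: (probability_ge_limsup _ (mA n u) (@limsup_above n u) _ (@tail_prod_cvg n u)).
    apply: measurableI => //; apply: fin_bigcap_measurable; first exact: finite_II.
    move=> j _; rewrite (_ : [set _ | _] =
      [set: T] `&` interarrival j @^-1` `[u j, +oo[%classic).
      by apply: measurable_interarrival.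
    by rewrite setTI; apply/seteqP; split => w /=; rewrite in_itv/= andbT.
  by move=> k; rewrite PA.
(* The event with >= at thresholds raised by 1/(k+1) lies in the event with > at [t]; letting the
   shift tend to 0 gives the lower bound. *)
have cu : \prod_(j < n) interarrival_tail (t j + harmonic k) @[k --> \oo]
    --> \prod_(j < n) interarrival_tail (t j).
  exact: (cvg_prod_ord (fun j => @tail_right_continuous (t j))).
have -> : P (Om `&` \bigcap_(j < n) [set w | t j < interarrival j w])
    = (fine (P (above n t)))%:E by rewrite fineK// fin_num_measure.
rewrite lee_fin; apply: ler_cvg_to cu (cvg_cst _) _; apply: nearW => k.
rewrite -lee_fin fineK ?fin_num_measure//.
apply: le_trans (ge_tail (fun j => t j + harmonic k)) _.
apply: le_measure; rewrite ?inE//.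
  apply: measurableI => //; apply: fin_bigcap_measurable; first exact: finite_II.
  move=> j _; rewrite (_ : [set _ | _] =
    [set: T] `&` interarrival j @^-1` `[t j + harmonic k, +oo[%classic).
    by apply: measurable_interarrival.
  by rewrite setTI; apply/seteqP; split => w /=; rewrite in_itv/= andbT.
move=> w [Ow Jw]; split => // j jn; apply: lt_le_trans (Jw j jn).
by rewrite ltrDl harmonic_gt0.
Qed.

Let tail_neg : interarrival_tail (-1) = 1.
Proof.
rewrite /interarrival_tail (_ : [set _ | _] = setT) ?probability_setT//.
apply/seteqP; split => w //= _.
by rewrite (lt_le_trans _ (interarrival_ge0 0 w))// ltrN10.
Qed.

Lemma interarrival_fset_tail (F : {fset nat}) (t : nat -> R) :
  P (\bigcap_(i in [set` F]) [set w | t i < interarrival i w])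
  = (\prod_(i <- F) interarrival_tail (t i))%:E.
Proof.
(* Indices outside [F] get the threshold -1, which every waiting time exceeds, so [F] extends to an
   initial segment at no cost. *)
pose u i := if i \in F then t i else -1.
pose n := (\max_(i <- F) i).+1.
have Fn i : i \in F -> (i < n)%N.
  by move=> iF; rewrite ltnS (leq_bigmax_seq (F := id)).
have -> : \bigcap_(i in [set` F]) [set w | t i < interarrival i w]
    = \bigcap_(i < n) [set w | u i < interarrival i w].
  apply/seteqP; split => w Hw i /=.
    move=> _; rewrite /u; case: ifPn => [iF|_]; first exact: Hw.
    by rewrite (lt_le_trans _ (interarrival_ge0 i w))// ltrN10.
  by move=> iF; have := Hw i (Fn i iF); rewrite /= /u iF.
rewrite interarrival_joint_tail; congr (_%:E).
rewrite -(big_mkord xpredT (fun i => interarrival_tail (u i))).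
rewrite (bigID (mem F))/= [X in _ * X]big1 ?mulr1; last first.
  by move=> i /negbTE iF; rewrite /u iF tail_neg.
rewrite -big_filter; under eq_big_seq => i.
  by rewrite mem_filter => /andP[iF _]; rewrite /u iF; over.
apply: perm_big; apply: uniq_perm; rewrite ?filter_uniq ?iota_uniq ?fset_uniq//.
move=> i; rewrite mem_filter mem_index_iota /=.
by apply/andP/idP => [[]//|iF]; rewrite iF Fn.
Qed.

End renewal_limit.

(** * The tail of the first waiting time as an expectation *)

Section tail.
Context (d : measure_display) (T : measurableType d) (R : realType).
Variable P : probability T R.
Variables (D : R -> T -> R) (N : R -> T -> nat) (lambda : R) (Om : set T).
Hypothesis D_levy : levy_process P D.
Hypothesis N_poisson : poisson_process P lambda N.
Hypothesis lambda_gt0 : 0 < lambda.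
Hypothesis ND_indep : independent_processes P N D.
Hypothesis mOm : measurable Om.
Hypothesis POm : P Om = 1%E.
Hypothesis Om_good : forall w, Om w -> good_path D N w.

Variable t : R.
Hypothesis t_ge0 : 0 <= t.

Let crossing (h : R) (g : nat) : set T :=
  D (g%:R * h) @^-1` `]-oo, t]%classic `&` D (g.+1%:R * h) @^-1` `]t, +oo[%classic.

Let crossingP h g w : crossing h g w <-> D (g%:R * h) w <= t /\ t < D (g.+1%:R * h) w.
Proof. by rewrite /crossing /= !in_itv/= andbT. Qed.

(** Probability that N has no jump up to the right end of cell [g]. *)
Let discount (h : R) (g : nat) : R := expR (- (lambda * (g.+1%:R * h))).

Let D_le w s u : Om w -> 0 <= s -> s <= u -> D s w <= D u w.
Proof.
move=> /Om_good good s0; rewrite le_eqVlt => /predU1P[->//|su].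
exact/ltW/(good_D_lt good).
Qed.

Let crossing_sigma h g : 0 < h -> process_sigma_algebra D (crossing h g).
Proof.
move=> h0; pose G := [set A | exists t (B : set R),
    [/\ 0 <= t, measurable B & A = D t @^-1` B]].
apply: (@measurableI _ (g_sigma_algebraType G)); apply: sub_sigma_algebra.
  by exists (g%:R * h), `]-oo, t]%classic; split => //; rewrite mulr_ge0// ltW.
by exists (g.+1%:R * h), `]t, +oo[%classic; split => //; rewrite mulr_ge0// ltW.
Qed.

Let measurable_crossing h g : 0 < h -> measurable (crossing h g).
Proof.
move=> h0; have s0 k : 0 <= k%:R * h by rewrite mulr_ge0// ltW.
apply: measurableI; rewrite -[_ @^-1` _]setTI;
  by apply: (levy_measurable D_levy (s0 _)).
Qed.

Let measurable_N0 s : 0 <= s -> measurable (N s @^-1` [set 0%N]).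
Proof.
move=> s0; rewrite (_ : _ @^-1` _ = [set: T] `&` (fun w => (N s w)%:R) @^-1` [set 0 : R]).
  by apply: (levy_measurable N_poisson.1).
rewrite setTI; apply/seteqP; split => w /=; first by move=> ->.
by move=> /eqP; rewrite (eqr_nat R _ 0) => /eqP.
Qed.

Let probability_crossing h g : 0 < h ->
  P (crossing h g `&` N (g.+1%:R * h) @^-1` [set 0%N])
  = ((discount h g)%:E * P (crossing h g))%E.
Proof.
move=> h0; have s0 : 0 < g.+1%:R * h by rewrite mulr_gt0.
rewrite setIC ND_indep; last exact: crossing_sigma.
  congr (_ * _)%E; rewrite N_poisson.2// /poisson_pmf mulr_gt0//.
  by rewrite expr0 fact0 invr1 !mul1r.
by apply: sub_sigma_algebra; exists (g.+1%:R * h), [set 0%N]; split => //; exact: ltW.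
Qed.

Let crossing_inj w h g g' : 0 < h -> Om w -> crossing h g w -> crossing h g' w ->
  g = g'.
Proof.
move=> h0 Ow /crossingP[l1 u1] /crossingP[l2 u2].
have key a b : D (a%:R * h) w <= t -> t < D (b.+1%:R * h) w -> (a <= b)%N.
  move=> la ub; rewrite leqNgt; apply/negP => ba.
  have : D (b.+1%:R * h) w <= D (a%:R * h) w.
    by apply: D_le => //; [rewrite mulr_ge0// ltW|rewrite ler_pM2r// ler_nat].
  by rewrite leNgt (le_lt_trans la).
by apply/eqP; rewrite eqn_leq; apply/andP; split; exact: key.
Qed.

Let crossing_exists w h K : 0 < h -> Om w -> t < D (K%:R * h) w ->
  exists2 g, (g < K)%N & crossing h g w.
Proof.
move=> h0 Ow tK; have exK : exists m, t < D (m%:R * h) w by exists K.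
have := ex_minnP exK; case=> -[|g] tg gmin.
  by move: tg; rewrite mul0r (good_D0 (Om_good Ow)) ltNge t_ge0.
exists g; first exact: gmin.
by apply/crossingP; split => //; rewrite leNgt; apply/negP => /gmin; rewrite ltnn.
Qed.

Let near_crossing w : Om w -> \forall k \near \oo,
  exists2 g, (g < k.+1 ^ 2)%N & crossing (harmonic k) g w.
Proof.
move=> Ow; have [r r0 tr] := good_D_unbounded (Om_good Ow) t.
near=> k; apply: crossing_exists => //; first exact: harmonic_gt0.
rewrite (lt_le_trans tr)// D_le// /harmonic/= natrX expr2 mulfK ?pnatr_eq0//.
rewrite (@le_trans _ _ k%:R) ?ler_nat//; near: k; exact: nbhs_infty_ger.
Unshelve. all: by end_near. Qed.

(** Discretization of exp(- lambda E(t)): at most one term is nonzero, that of the cell in which D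
    crosses t, and the right end of this cell is within one step of E(t). *)
Let F (k : nat) (w : T) : R := \sum_(g < k.+1 ^ 2)
  discount (harmonic k) g * \1_(crossing (harmonic k) g `&` Om) w.

Let survival (w : T) : R :=
  if w \in Om then expR (- (lambda * fine (inverse_process D t w))) else 0.

Let F_crossing k g w : Om w -> (g < k.+1 ^ 2)%N -> crossing (harmonic k) g w ->
  F k w = discount (harmonic k) g.
Proof.
move=> Ow gK cg; rewrite /F (bigD1 (Ordinal gK))//= indicE mem_set// mulr1.
rewrite big1 ?addr0// => g' g'g; rewrite indicE memNset ?mulr0// => -[cg' _].
move/eqP: g'g; apply; apply: val_inj => /=.
exact: (crossing_inj (harmonic_gt0 k) Ow cg' cg).
Qed.

Let F_bounds k w : 0 <= F k w <= 1.
Proof.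
apply/andP; split.
  by apply: sumr_ge0 => g _; rewrite mulr_ge0 ?expR_ge0// indicE.
have [[Ow [g gK cg]]|H] := pselect (Om w /\
    exists2 g, (g < k.+1 ^ 2)%N & crossing (harmonic k) g w).
  rewrite (F_crossing Ow gK cg) -expR0 ler_expR oppr_le0.
  by rewrite !mulr_ge0// ?harmonic_ge0// ltW.
rewrite /F big1// => g _; rewrite indicE memNset ?mulr0// => -[cg Ow].
by apply: H; split => //; exists g.
Qed.

Let F_cvg w : F k w @[k --> \oo] --> survival w.
Proof.
rewrite /survival; case: ifPn => [|Ow]; last first.
  rewrite (_ : F ^~ w = fun=> 0); first exact: cvg_cst.
  apply/funext => k; rewrite /F big1// => g _.
  by rewrite indicE memNset ?mulr0// => -[_ /mem_set]; exact/negP.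
rewrite inE => Ow; have good := Om_good Ow; set e := fine _.
have [Efin E0] := inverse_fin good t_ge0.
have lo : expR (- (lambda * harmonic k)) * expR (- (lambda * e)) @[k --> \oo]
    --> expR (- (lambda * e)).
  rewrite -[X in _ --> X]mul1r.
  by apply: cvgM; [exact: cvg_expR_harmonic|exact: cvg_cst].
apply: (squeeze_cvgr _ lo (cvg_cst _)); near=> k.
have [g gK cg] : exists2 g, (g < k.+1 ^ 2)%N & crossing (harmonic k) g w.
  by near: k; exact: near_crossing.
have h0 := @harmonic_gt0 R k.
rewrite (F_crossing Ow gK cg) /discount -expRD !ler_expR.
have /crossingP[l u] := cg.
have le1 : e <= g.+1%:R * harmonic k.
  by apply: (inverse_le good t_ge0) => //; rewrite mulr_ge0// ltW.
have ge1 : g%:R * harmonic k <= e.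
  by apply: (inverse_ge good t_ge0) => //; rewrite mulr_ge0// ltW.
have gE : g.+1%:R * harmonic k = g%:R * harmonic k + harmonic k :> R.
  by rewrite -natr1 mulrDl mul1r.
rewrite lerN2 ler_pM2l// le1 andbT -opprD lerN2 -mulrDr ler_pM2l// gE; lra.
Unshelve. all: by end_near. Qed.

(** Grid version of t < tau_1, contained in it: N has not jumped by the end of the cell in which D
    crosses t. *)
Let C (k : nat) : set T := \bigcup_(g < k.+1 ^ 2)
  (crossing (harmonic k) g `&` N (g.+1%:R * harmonic k) @^-1` [set 0%N] `&` Om).

Let mC0 k g : measurable
  (crossing (harmonic k) g `&` N (g.+1%:R * harmonic k) @^-1` [set 0%N]).
Proof.
apply: measurableI; first exact: (measurable_crossing _ (harmonic_gt0 k)).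
by apply: measurable_N0; rewrite mulr_ge0// harmonic_ge0.
Qed.

Let mC k : measurable (C k).
Proof.
apply: fin_bigcup_measurable => [|g _]; first exact: finite_II.
exact: measurableI.
Qed.

Let mF k : measurable_fun setT (F k).
Proof.
apply: measurable_sum => g; apply: measurable_funM => //.
apply: measurable_indic; apply: measurableI => //.
exact: (measurable_crossing _ (harmonic_gt0 k)).
Qed.

(** The crossing cell is determined by D, so independence replaces the event N = 0 by its
    probability, cell by cell. *)
Let PC k : P (C k) = (\int[P]_w (F k w)%:E)%E.
Proof.
have mc g : measurable (crossing (harmonic k) g).
  exact: (measurable_crossing _ (harmonic_gt0 k)).
rewrite measure_fin_bigcup; last 3 first.
- exact: finite_II.
- apply/trivIsetP => g g' _ _ gg'; apply/seteqP; split => // w.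
  move=> [[[cg _] Ow] [[cg' _] _]]; move/eqP: gg'; apply.
  exact: (crossing_inj (harmonic_gt0 k) Ow cg cg').
- by move=> g _; exact: measurableI.
rewrite -fsbig_ord.
under [RHS]eq_integral do rewrite /F -sumEFin.
rewrite ge0_integral_sum//; last 2 first.
- move=> g; apply/measurable_EFinP/measurable_funM => //.
  by apply: measurable_indic; exact: measurableI.
- by move=> g w _; rewrite lee_fin mulr_ge0 ?expR_ge0// indicE.
apply: eq_bigr => g _.
under eq_integral do rewrite EFinM.
rewrite ge0_integralZl//; last 2 first.
- by apply/measurable_EFinP/measurable_indic; exact: measurableI.
- by rewrite lee_fin expR_ge0.
rewrite integral_indic//; last exact: measurableI.
rewrite setIT; have := probability_crossing g (harmonic_gt0 k).
rewrite -(probability_setI1 (mC0 k g) mOm POm).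
by rewrite -(probability_setI1 (mc g) mOm POm).
Qed.

Lemma passage1_tail :
  P (Om `&` [set w | t < passage D N 1 w])
  = (\int[P]_w expeR (- (lambda%:E * inverse_process D t w)))%E.
Proof.
pose X := Om `&` [set w | t < passage D N 1 w].
have mX : measurable X.
  rewrite (_ : X = Om `&` (passage_on D N Om 1 @^-1` `]t, +oo[%classic)).
    apply: measurableI => //; rewrite -[_ @^-1` _]setTI.
    by apply: (measurable_passage_on D_levy N_poisson mOm Om_good).
  apply/seteqP; split => w [Ow]; rewrite /= in_itv/= andbT passage_onE//.
have CX k : C k `<=` X.
  move=> w [g _ [[/crossingP[_ tD] N0] Ow]]; split => //=.
  apply/(lt_passageP (Om_good Ow)); exists (g.+1%:R * harmonic k); split.
  - by rewrite mulr_ge0// harmonic_ge0.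
  - by rewrite N0.
  - exact: tD.
have XC (w : T) : X w -> \forall k \near \oo, C k w.
  move=> [Ow tX]; have [del del0 H] := passage1_inverse_near (Om_good Ow) t_ge0 tX.
  near=> k; have [g gK cg] : exists2 g, (g < k.+1 ^ 2)%N & crossing (harmonic k) g w.
    by near: k; exact: near_crossing.
  exists g => //; split => //; split => //.
  have -> : g.+1%:R * harmonic k = g%:R * harmonic k + harmonic k :> R.
    by rewrite -natr1 mulrDl mul1r.
  have /crossingP[Dg _] := cg; apply: H Dg; last by near: k; exact: harmonic_lt.
    by rewrite mulr_ge0// harmonic_ge0.
  exact: harmonic_gt0.
Unshelve. all: end_near.
have PCX : P (C k) @[k --> \oo] --> P X.
  rewrite -[P X]fineK ?fin_num_measure//; apply: cvg_EFin.
    by apply: nearW => k; rewrite fin_num_measure.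
  apply: (probability_cvg_inner mX mC mC XC CX (e := fun=> 0)); last exact: cvg_cst.
  by move=> k; rewrite adde0.
have F_abs k w : (`|(F k w)%:E| <= 1%:E)%E.
  by have /andP[F0 F1] := F_bounds k w; rewrite gee0_abs lee_fin.
have msurv : measurable_fun setT survival.
  by apply: (measurable_fun_cvg mF) => w _; exact: F_cvg.
have F_ecvg w : (F k w)%:E @[k --> \oo] --> (survival w)%:E.
  by apply: cvg_EFin; [exact: nearW|exact: F_cvg].
have [_ _ /= Fint] := @dominated_convergence _ _ _ P setT measurableT
  (fun k w => (F k w)%:E) (fun w => (survival w)%:E) (fun=> 1%E)
  (fun k => (measurable_EFinP _ _).2 (mF k)) ((measurable_EFinP _ _).2 msurv)
  (aeW _ (fun w _ => F_ecvg w))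
  (finite_measure_integrable_cst _ 1 measurableT)
  (aeW _ (fun w k _ => F_abs k w)).
(* P(C k) is the integral of [F k], so its two limits agree. The measurable [survival] stands in for
   exp(- lambda E(t)), with which it coincides on [Om]. *)
rewrite (@ge0_integral_full _ _ _ P _ (fun w => (survival w)%:E) Om)//.
- have CF : (fun k => P (C k)) = (fun k => \int[P]_w (F k w)%:E)%E.
    by apply/funext => k; exact: PC.
  by rewrite CF in PCX; exact: (cvg_unique _ PCX Fint).
- exact/measurable_EFinP.
- move=> w; rewrite expeR_ge0/= -expeR0 lee_expeR oppe_le0 mule_ge0//.
    by rewrite lee_fin ltW.
  by apply: le_ereal_inf_tmp => _ [s [s0 _] <-]; rewrite lee_fin ltW.
- move=> w Ow; rewrite /survival mem_set//.
  have [Efin _] := inverse_fin (Om_good Ow) t_ge0.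
  by rewrite -{1}(fineK Efin).
- by move=> w Ow; rewrite /survival memNset.
Qed.
End tail.

(** * Construction of the waiting times and conclusion *)

Lemma full_ae (d : measure_display) (T : measurableType d) (R : realType)
    (P : probability T R) (Om : set T) (Q : T -> Prop) :
  measurable Om -> P Om = 1%E -> (forall w, Om w -> Q w) -> {ae P, forall w, Q w}.
Proof.
move=> mOm POm OmQ; exists (~` Om); split; first exact: measurableC.
  by rewrite probability_setC// POm subee.
by move=> w nQ Ow; apply: nQ; exact: OmQ.
Qed.

Theorem theorem4p1 (R : realType) (d : measure_display) (T : measurableType d)
    (P : probability T R) (D : R -> T -> R) (N1 : R -> T -> nat)
    (lambda b : R) (phi : {measure set (measurableTypeR R) -> \bar R})
    (D_levy : levy_process P D)
    (D_incr : strictly_increasing_paths P D)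
    (b_ge0 : 0 <= b)
    (phi_levy : subordinator_levy_measure phi)
    (D_laplace : forall s t : R, 0 <= s -> 0 <= t ->
      ('E_P[fun w => expR (- (s * D t w))%R]
        = (expR (- (t * laplace_exponent b phi s))%R)%:E)%E)
    (lambda_gt0 : 0 < lambda)
    (N1_poisson : poisson_process P lambda N1)
    (N1_D_indep : independent_processes P N1 D) :
  let E := inverse_process D in
  let Y := time_changed N1 E in
  exists J : nat -> {RV P >-> R},
    [/\ renewal_process Y J,
        {ae P, forall w, forall n, waiting_time Y n w = (J n w)%:E}
      & forall (n : nat) (t : R), 0 <= t ->
          P [set w | t < J n w] =
          (\int[P]_w expeR (- (lambda%:E * E t w)))%E ].
Proof.
move=> E Y.
have D_laplace1 t : 0 <= t ->
    ('E_P[fun w => expR (- D t w)%R]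
      = (expR (- (t * laplace_exponent b phi 1))%R)%:E)%E.
  by move=> t0; rewrite -(D_laplace 1 t)//; under [in RHS]eq_fun do rewrite mul1r.
have [OD [mOD POD D_path]] := subordinator_paths D_levy D_incr D_laplace1.
have [ON [mON PON N_path]] := poisson_good_paths D_levy N1_poisson lambda_gt0 N1_D_indep.
pose Om := OD `&` ON.
have mOm : measurable Om by exact: measurableI.
have POm : P Om = 1%E by rewrite /Om probability_setI1.
have Om_good w : Om w -> good_path D N1 w.
  by move=> [/D_path[D0 Dlt Doo] /N_path[N0 Nle Nright Noo]]; split.
have mJ n : measurable_fun setT (interarrival D N1 Om n).
  exact: (measurable_interarrival D_levy N1_poisson mOm Om_good).
pose J n : {RV P >-> R} := HB.pack (interarrival D N1 Om n)
  (isMeasurableFun.Build _ _ _ _ (interarrival D N1 Om n) (mJ n)).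
have JE n w : Om w -> J n w = passage D N1 n.+1 w - passage D N1 n w.
  by move=> Ow; rewrite /= /interarrival !passage_onE.
have tails := interarrival_fset_tail D_levy N1_poisson lambda_gt0 N1_D_indep
  mOm POm Om_good.
have tail n t : P [set w | t < J n w] = (interarrival_tail P D N1 Om t)%:E.
  have := tails [fset n]%fset (fun=> t).
  by rewrite set_fset1 bigcap_set1 big_seq_fset1.
exists J; split; [split| |].
- exact: (interarrival_ge0 Om_good).
- apply: mutually_independent_rays => F t; rewrite tails -prodEFin.
  by apply: eq_bigr => i _; rewrite tail.
- by move=> m n; apply: same_distribution_rays => t; rewrite !tail.
- apply: (full_ae mOm POm) => w Ow t t0; have good := Om_good w Ow.
  (* Partial sums telescope to the passage values, so the maximality of Y(t) becomes the equivalence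
     [time_changed_lt]. *)
  have sumJ n : \sum_(i < n) J i w = passage D N1 n w.
    rewrite (eq_bigr (fun i : 'I_n => passage D N1 i.+1 w - passage D N1 i w)).
      rewrite -(big_mkord xpredT (fun i => passage D N1 i.+1 w - passage D N1 i w)).
      by rewrite telescope_sumr// passage0 subr0.
    by move=> i _; exact: JE.
  split=> [|n]; rewrite sumJ.
    by rewrite leNgt; apply/negP => /(time_changed_lt good _ t0); rewrite ltnn.
  by move=> nt; rewrite leqNgt; apply/negP => /(time_changed_lt good _ t0); rewrite ltNge nt.
- apply: (full_ae mOm POm) => w Ow n; have good := Om_good w Ow.
  rewrite JE//; case: n => [|n]; first by rewrite /waiting_time jump_time_passage// passage0 subr0.
  by rewrite /waiting_time !jump_time_passage// EFinB.
- move=> n t t0; rewrite tail -(tail 0%N).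
  rewrite -(passage1_tail D_levy N1_poisson lambda_gt0 N1_D_indep mOm POm Om_good t0).
  rewrite -(@probability_setI1 _ _ _ P _ Om)//.
    have J0 w : Om w -> J 0%N w = passage D N1 1 w.
      by move=> Ow; rewrite JE// passage0 subr0.
    rewrite [in LHS]setIC; congr (P _).
    by apply/seteqP; split => w [Ow tJ]; split => //; move: tJ;
      rewrite /mkset (J0 w Ow).
  rewrite (_ : [set _ | _] = [set: T] `&` J 0%N @^-1` `]t, +oo[%classic).
    by apply: measurable_funP.
  by rewrite setTI; apply/seteqP; split => w /=; rewrite in_itv/= andbT.
Qed.
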